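(* Let $n\ge1$, $E=\mathbb{C}^n$ and $\Phi,\Psi\in L^\infty_{B(E)}$. Then $H_\Phi T_\Psi$ is a block Hankel operator on the vector-valued Hardy space $H^2_E$ if and only if there exists a complex $n\times n$ matrix $A$, all of whose entries have modulus at most $1$, such that $$\Phi(I-A)\in H^\infty_{B(E)}\quad\text{and}\quad A\Psi\in H^\infty_{B(E)} .$$ In this case, $H_\Phi T_\Psi=H_{\Phi A\Psi}$.
   Context: $\mathbb{T}$ is the unit circle. For $E=\mathbb{C}^n$, $L^2_E$ is the space of $E$-valued square-integrable functions on $\mathbb T$, $H^2_E$ the $E$-valued Hardy space, $L^\infty_{B(E)}$ the algebra of essentially bounded $n\times n$ matrix-valued functions on $\mathbb{T}$, and $H^\infty_{B(E)}$ its subalgebra of matrix functions all of whose entries are in $H^\infty$. $P$ is the orthogonal projection of $L^2_E$ onto $H^2_E$, $Q=I-P$, and $(Jf)(w)=\overline{w}f(\overline{w})$ on $L^2_E$. For $\Phi\in L^\infty_{B(E)}$ the block Toeplitz operator on $H^2_E$ is $T_\Phi h=P[\Phi h]$ and the block Hankel operator on $H^2_E$ is $H_\Phi h=JQ[\Phi h]$. A bounded operator $X$ on $H^2_E$ is a block Hankel operator if it equals $H_F$ for some symbol $F$; these operators are characterized by the equation $XS_E=S_E^*X$, where $S_E$ is the shift (multiplication by the independent variable) on $H^2_E$. *)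

(* Defs.v *)
From HB Require Import structures.
From mathcomp Require Import all_boot all_order all_algebra.
From mathcomp.real_closed Require Export complex.
From mathcomp Require Import all_classical all_reals all_analysis.

Set Implicit Arguments.
Unset Strict Implicit.
Unset Printing Implicit Defensive.
Import Order.TTheory GRing.Theory Num.Theory.
Import numFieldNormedType.Exports.

Local Open Scope classical_set_scope.
Local Open Scope ring_scope.

Definition circle (R : realType) : Type := {w : R[i] | `|w| == 1}.

Section circle.
Variable R : realType.

HB.instance Definition _ := SubType.on (circle R).
HB.instance Definition _ := Choice.on (circle R).

Lemma expi_subproof (t : R) : `|Complex (cos t) (sin t)| == 1.
Proof. by rewrite normc_def/= cos2Dsin2 sqrtr1. Qed.

Definition expi (t : measurableTypeR R) : circle R :=
  exist (fun w : R[i] => `|w| == 1) _ (expi_subproof t).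

Lemma cconj_subproof (w : circle R) : `|conjc (val w)| == 1.
Proof.
by case: w => -[a b] /=; rewrite !normc_def/= sqrrN.
Qed.

Definition cconj (w : circle R) : circle R :=
  exist (fun w : R[i] => `|w| == 1) _ (cconj_subproof w).

HB.instance Definition _ := isPointed.Build (circle R) (expi 0).

(* The restriction of expi to [0, 2 pi[ is a Borel isomorphism onto the circle
   and expi is 2 pi-periodic, so the final sigma-algebra of expi is the Borel
   sigma-algebra of the circle. *)
Definition circle_measurable : set (set (circle R)) :=
  image_set_system setT expi measurable.

Lemma circle_measurable0 : circle_measurable set0.
Proof. by rewrite /circle_measurable/image_set_system/= preimage_set0 setI0. Qed.

Lemma circle_measurableC A : circle_measurable A -> circle_measurable (~` A).
Proof.
by rewrite /circle_measurable/image_set_system/= !setTI preimage_setC;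
  exact: measurableC.
Qed.

Lemma circle_measurable_bigcup (F : (set (circle R))^nat) :
  (forall i, circle_measurable (F i)) -> circle_measurable (\bigcup_i F i).
Proof.
rewrite /circle_measurable/image_set_system/= => mF.
rewrite setTI preimage_bigcup; apply: bigcup_measurable => k _.
by move: (mF k); rewrite setTI.
Qed.

HB.instance Definition _ := @isMeasurable.Build default_measure_display
  (circle R) circle_measurable circle_measurable0 circle_measurableC
  circle_measurable_bigcup.

Lemma measurable_expi : measurable_fun [set: measurableTypeR R] expi.
Proof. by []. Qed.

Lemma pi2_gt0 : (0 : R) < 2 * pi.
Proof. by rewrite mulr_gt0// pi_gt0. Qed.

HB.instance Definition _ :=
  isMeasurableFun.Build _ _ (measurableTypeR R) (circle R) expi
    measurable_expi.

(* Normalized arc length. *)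
Definition circle_measure : probability (circle R) R :=
  distribution (uniform_prob pi2_gt0) expi.

End circle.

Section function_spaces.
Variable R : realType.
Local Notation C := R[i].
Local Notation m := (@circle_measure R).
Implicit Type p : \bar R.

Definition measurable_complex (f : circle R -> C) : Prop :=
  measurable_fun setT (fun w => complex.Re (f w)) /\
  measurable_fun setT (fun w => complex.Im (f w)).

Definition Lp p (f : circle R -> C) : Prop :=
  measurable_complex f /\ finite_norm m p (fun w => Normc.normc (f w)).

Definition cintegral (f : circle R -> C) : C :=
  Complex (\int[m]_w complex.Re (f w)) (\int[m]_w complex.Im (f w)).

Definition fourier (f : circle R -> C) (k : int) : C :=
  cintegral (fun w => f w * val w ^ (- k)).

Definition Hp p (f : circle R -> C) : Prop :=
  Lp p f /\ forall k : int, k < 0 -> fourier f k = 0.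

Definition LinfM n (F : circle R -> 'M[C]_n) : Prop :=
  forall i j, Lp +oo%E (fun w => F w i j).

Definition HinfM n (F : circle R -> 'M[C]_n) : Prop :=
  forall i j, Hp +oo%E (fun w => F w i j).

Definition enorm n (v : 'cV[C]_n) : R :=
  Num.sqrt (\sum_i Normc.normc (v i 0) ^+ 2).

Definition L2E n (f : circle R -> 'cV[C]_n) : Prop :=
  (forall i, measurable_complex (fun w => f w i 0)) /\
  finite_norm m 2%:E (fun w => enorm (f w)).

Definition H2E n (f : circle R -> 'cV[C]_n) : Prop :=
  L2E f /\ forall i (k : int), k < 0 -> fourier (fun w => f w i 0) k = 0.

Definition innerE n (f g : circle R -> 'cV[C]_n) : C :=
  cintegral (fun w => \sum_i f w i 0 * conjc (g w i 0)).

(* Elements of L^2_E are represented by functions, so operators are maps on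
   representatives and are compared almost everywhere.  [projH2 f] is a chosen
   representative of the orthogonal projection of the class of [f]; it is
   determined up to a null set. *)
Definition projH2 n (f : circle R -> 'cV[C]_n) : circle R -> 'cV[C]_n :=
  xget (cst 0)
    [set g | H2E g /\ forall u, H2E u -> innerE (fun w => f w - g w) u = 0].

Definition coprojH2 n (f : circle R -> 'cV[C]_n) : circle R -> 'cV[C]_n :=
  fun w => f w - projH2 f w.

Definition flip n (f : circle R -> 'cV[C]_n) : circle R -> 'cV[C]_n :=
  fun w => conjc (val w) *: f (cconj w).

Definition toeplitz n (F : circle R -> 'M[C]_n)
    (h : circle R -> 'cV[C]_n) : circle R -> 'cV[C]_n :=
  projH2 (fun w => F w *m h w).

Definition hankel n (F : circle R -> 'M[C]_n)
    (h : circle R -> 'cV[C]_n) : circle R -> 'cV[C]_n :=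
  flip (coprojH2 (fun w => F w *m h w)).

Definition eq_on_H2E n
    (X Y : (circle R -> 'cV[C]_n) -> circle R -> 'cV[C]_n) : Prop :=
  forall h, H2E h -> X h = Y h %[ae m].

(* [hankel F] is bounded for [F] in L^infty, so boundedness of [X] is implied. *)
Definition block_hankel n
    (X : (circle R -> 'cV[C]_n) -> circle R -> 'cV[C]_n) : Prop :=
  exists2 F : circle R -> 'M[C]_n, LinfM F & eq_on_H2E X (hankel F).

End function_spaces.

(* Main.v *)
Require Import Defs.
From mathcomp Require Import all_boot all_order all_algebra.
From mathcomp.real_closed Require Import complex.
From mathcomp Require Import all_classical all_reals all_analysis.
From mathcomp Require Import measurable_realfun ess_sup_inf ring lra.

(** The whole question is decided by the matrix Fourier coefficients of the two
    symbols, written Phi^(k) and Psi^(l): [H_Phi T_Psi] is a block Hankel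
    operator exactly when [Phi^(k) Psi^(l) = 0] for all [k, l < 0].

    Let S be the shift.  The Fourier coefficients of [H_F h] are those of F h at
    negative indices, so a Hankel operator X satisfies [X S = S' X] with S' the
    backward shift.  A Toeplitz operator commutes with
    S up to a constant: [T_Psi S h = S T_Psi h + c(h)], where c(h) is the
    coefficient of Psi h at -1 (lemma [toeplitz_shift]).  Hence if
    [H_Phi T_Psi] is a Hankel operator then [H_Phi c(h) = 0] for all h, that is,
    [Phi^(k) c(h) = 0] for [k < 0].  For [h = z^d e_j] the vector c(h) is the
    j-th column of Psi^(-d-1), whence [Phi^(k) Psi^(l) = 0]
    (lemma [block_hankel_fourierM]).

    Given these relations, let A be the orthogonal projector onto the largest
    row space annihilating all Psi^(l) with [l < 0].  Then [A Psi^(l) = 0], and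
    A fixes the rows of all Phi^(k), which is to say that [A Psi] and
    [Phi (1 - A)] are analytic.  The entries of an orthogonal projector have
    modulus at most 1, which is the bound of the theorem
    (lemma [contractive_separation]).

    Conversely, suppose that A makes both products analytic, and let P be the
    projection onto the Hardy space.  For h in the Hardy space [A Psi h] is
    analytic, so [A P(Psi h) = A Psi h], and
    [Phi P(Psi h) = Phi A Psi h + Phi (1 - A) P(Psi h)], where the last term is
    analytic.  Applying 1 - P and flipping gives
    [H_Phi T_Psi h = H_(Phi A Psi) h] (lemma [hankel_toeplitz]).

    The analysis behind this is of three kinds.  The projection P must exist:
    this is the projection theorem for closed subspaces ([si_projection]), which
    rests on the completeness of L2 ([Lfun2_complete], [L2E_complete]).  A
    bounded analytic matrix must map the Hardy space to itself ([HinfM_H2E]):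
    by duality this reduces to analytic polynomials, which are dense in the
    Hardy space because a square-integrable function all of whose Fourier
    coefficients vanish is zero almost everywhere ([fourier_unique]).  The
    latter is proved by approximating indicators of arcs by trigonometric
    polynomials and differentiating.  Finally, null sets must be invariant
    under conjugation, so that [flip] is compatible with almost everywhere
    equality ([ae_cconj]). *)

Set Implicit Arguments.
Unset Strict Implicit.
Unset Printing Implicit Defensive.
Import Order.TTheory GRing.Theory Num.Theory.
Import numFieldNormedType.Exports.

Local Open Scope classical_set_scope.
Local Open Scope ring_scope.

(** * Separation by an orthogonal projector *)

Section orthogonal_projector.
Variable C : numClosedFieldType.

(** The matrix is an orthogonal projector A: it is idempotent and Hermitian.
    So the squared moduli in row i sum to A i i, which makes A i i at most 1
    and bounds every entry of the row. *)
Lemma unitary_projector_entry m n (U : 'M[C]_(m, n)) i j :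
  U \is unitarymx -> `|(map_mx Num.conj U^T *m U) i j| <= 1.
Proof.
move=> /unitarymxP UU; set A := _ *m U.
have AA : A *m A = A by rewrite /A mulmxA -(mulmxA _ U) UU mulmx1.
have AT k l : A l k = Num.conj (A k l).
  rewrite !mxE rmorph_sum/=; apply: eq_bigr => a _.
  by rewrite !mxE rmorphM/= conjCK mulrC.
have Aii k l : `|A k l| ^+ 2 <= A k k.
  have -> : A k k = \sum_a A k a * A a k by rewrite -{1}AA mxE.
  rewrite (bigD1 l)//= (AT k l) -normCK lerDl sumr_ge0// => a _.
  by rewrite (AT k a) -normCK exprn_ge0.
have A1 k : A k k <= 1.
  have A0 : 0 <= A k k by apply: le_trans (Aii k k); rewrite exprn_ge0.
  have := Aii k k; rewrite ger0_norm//.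
  move: A0; rewrite le_eqVlt => /predU1P[<-//|A0].
  by rewrite expr2 -{3}(mulr1 (A k k)) ler_pM2l.
by rewrite -(@expr_le1 _ 2%N)//; exact: le_trans (A1 i).
Qed.

(** A is the orthogonal projector onto a row space S of maximal rank among
    those annihilated by all D j.  Maximality makes S contain every B i, since
    B i + S is annihilated too; hence A fixes the rows of B i, while the rows of
    A lie in S and kill D j.  Being orthogonal, the projector has bounded
    entries. *)
Lemma contractive_separation n (I J : Type)
    (B : I -> 'M[C]_n) (D : J -> 'M[C]_n) :
  (forall i j, B i *m D j = 0) ->
  exists A : 'M[C]_n, [/\ forall k l, `|A k l| <= 1,
    forall i, B i *m (1%:M - A) = 0 & forall j, A *m D j = 0].
Proof.
move=> BD.
pose ann (S : 'M[C]_n) := forall j, S *m D j = 0.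
pose P (r : nat) := `[< exists2 S, ann S & \rank S = r >].
have exP : exists r, P r.
  by exists 0%N; apply/asboolP; exists 0; rewrite ?mxrank0// => j; rewrite mul0mx.
have ubP r : P r -> (r <= n)%N by move=> /asboolP[S _ <-]; exact: rank_leq_row.
case: (ex_maxnP exP ubP) => r /asboolP[S annS rS] maxr.
have rS' : (\rank S <= n)%N by exact: rank_leq_col.
pose U := schmidt (row_base S).
have Uu : U \is unitarymx by exact: schmidt_unitarymx.
have US : (U :=: S)%MS.
  by apply: eqmx_trans (eq_row_base S); exact: (eqmx_schmidt_free (row_base_free S)).
exists (map_mx Num.conj U^T *m U); split=> [k l|i|j].
- exact: unitary_projector_entry.
- have annBS : ann (B i + S)%MS.
    move=> j; apply/eqP; rewrite -submx0.
    rewrite (eqmxMr _ (addsmxE _ _)) mul_col_mx BD annS.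
    by rewrite col_mx_sub !sub0mx.
  have BS : (B i <= S)%MS.
    have := maxr (\rank (B i + S)%MS) (asboolT (ex_intro2 _ _ _ annBS erefl)).
    rewrite -rS => le_rk.
    apply: submx_trans (addsmxSl (B i) S) _.
    by have := mxrank_leqif_sup (addsmxSr (B i) S); case=> _ <-; rewrite eqn_leq le_rk mxrankS// addsmxSr.
  have /submxP[X ->] : (B i <= U)%MS by rewrite US.
  rewrite mulmxBr mulmx1 -!mulmxA (mulmxA U).
  by move/unitarymxP: Uu => ->; rewrite mul1mx subrr.
- have [X ->] : exists X, U = X *m S by apply/submxP; rewrite US.
  by rewrite -!mulmxA annS !mulmx0.
Qed.

End orthogonal_projector.

(** * Projection in a complete semi-inner product space *)

Section pre_hilbert.
Variable R : realType.
Local Notation C := R[i].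
Local Notation Re := complex.Re.
Local Notation Im := complex.Im.

Definition sqnorm (z : C) : R := Re z ^+ 2 + Im z ^+ 2.

Lemma sqnorm_ge0 z : 0 <= sqnorm z.
Proof. by rewrite addr_ge0// sqr_ge0. Qed.

Lemma sqnorm_eq0 z : sqnorm z = 0 -> z = 0.
Proof.
move=> /eqP; rewrite paddr_eq0 ?sqr_ge0// !sqrf_eq0 => /andP[/eqP a /eqP b].
by case: z a b => ? ? /= -> ->.
Qed.

Lemma sqnormD a b : sqnorm (a + b) <= 2 * sqnorm a + 2 * sqnorm b.
Proof.
case: a b => [a b] [c e]; rewrite /sqnorm /=.
have := sqr_ge0 (a - c); have := sqr_ge0 (b - e); nra.
Qed.

(** The quadratic inequality behind both the Cauchy-Schwarz inequality and
    the near-orthogonality of almost minimizing vectors.  For [0 < D] it is minimized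
    at [t = 1 / D]. *)
Lemma discriminant_bound (A B D : R) : 0 <= B -> 0 <= D ->
  (forall t, 0 <= A - 2 * t * B + t ^+ 2 * B * D) -> B <= A * D.
Proof.
move=> B0 D0 H; have [Dz|Dn0] := eqVneq D 0.
  move: H; rewrite Dz mulr0; case: (ltP 0 B) => // Bp H.
  have := H ((A + 1) / (2 * B)).
  have -> : 2 * ((A + 1) / (2 * B)) * B = A + 1 by field; lra.
  rewrite mulr0; lra.
have Dp : 0 < D by rewrite lt_def D0 andbT.
have := H D^-1.
have -> : A - 2 * D^-1 * B + D^-1 ^+ 2 * B * D = (A * D - B) / D by field; lra.
by rewrite pmulr_lge0 ?invr_gt0// subr_ge0.
Qed.

Variable V : lmodType C.

(** The form is only required to behave well on L, and it may degenerate: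
    square-integrable functions form a subset of all functions, and functions
    that agree almost everywhere are not identified. *)
Record semi_inner (L : V -> Prop) (ip : V -> V -> C) : Prop := SemiInner {
  si0 : L 0;
  si_lin : forall a x y, L x -> L y -> L (a *: x + y);
  si_ipl : forall a x y z, L x -> L y -> L z ->
    ip (a *: x + y) z = a * ip x z + ip y z;
  si_ipC : forall x y, L x -> L y -> ip y x = conjc (ip x y);
  si_ge0 : forall x, L x -> 0 <= Re (ip x x) }.

Variables (L : V -> Prop) (ip : V -> V -> C).
Hypothesis H : semi_inner L ip.
Local Notation N x := (Re (ip x x)).

Lemma siZ a x : L x -> L (a *: x).
Proof. by move=> Lx; rewrite -(addr0 (a *: x)); apply: (si_lin H) => //; exact: (si0 H). Qed.

Lemma siD x y : L x -> L y -> L (x + y).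
Proof. by move=> Lx Ly; rewrite -(scale1r x); exact: (si_lin H). Qed.

Lemma siB x y : L x -> L y -> L (x - y).
Proof. by move=> Lx Ly; rewrite addrC -scaleN1r; exact: (si_lin H). Qed.

Lemma ipDl x y z : L x -> L y -> L z -> ip (x + y) z = ip x z + ip y z.
Proof. by move=> Lx Ly Lz; rewrite -(scale1r x) (si_ipl H)// mul1r scale1r. Qed.

Lemma ipBl x y z : L x -> L y -> L z -> ip (x - y) z = ip x z - ip y z.
Proof.
by move=> Lx Ly Lz; rewrite addrC -scaleN1r (si_ipl H)// mulN1r addrC.
Qed.

Lemma ip0l z : L z -> ip 0 z = 0.
Proof. by move=> Lz; have := ipBl Lz Lz Lz; rewrite !subrr. Qed.

Lemma ipZl a x z : L x -> L z -> ip (a *: x) z = a * ip x z.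
Proof.
by move=> Lx Lz; rewrite -(addr0 (a *: x)) (si_ipl H)// ?ip0l ?addr0//; exact: (si0 H).
Qed.

(** All the geometry below is read off from this expansion of a squared
    seminorm. *)
Lemma si_expand a x y : L x -> L y ->
  N (x - a *: y) = N x - 2 * Re (conjc a * ip x y) + sqnorm a * N y.
Proof.
move=> Lx Ly; have Lay := siZ a Ly; have Lxy := siB Lx Lay.
rewrite ipBl// (si_ipC H Lxy Lx) (si_ipC H Lxy Lay) !ipBl//.
rewrite !(@ipZl _ y)// (si_ipC H Lay Lx) (si_ipC H Lay Ly) !ipZl//.
rewrite (si_ipC H Lx Ly).
have yy : Im (ip y y) = 0.
  have := si_ipC H Ly Ly; case: (ip y y) => p q [] /= E; lra.
rewrite /sqnorm; case: (ip y y) yy => p q /= ->.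
case: (ip x x) (ip x y) a {Lay Lxy} => [e f] [b c] [u v] /=.
ring.
Qed.

Lemma si_parallelogram x y : L x -> L y ->
  N (x - y) + 4 * N (2^-1 *: (x + y)) = 2 * N x + 2 * N y.
Proof.
move=> Lx Ly.
have -> : N (x - y) = N x - 2 * Re (ip x y) + N y.
  have := si_expand 1 Lx Ly; rewrite scale1r => ->.
  by rewrite conjc1 mul1r /sqnorm /= expr1n expr0n addr0 mul1r.
have -> : N (2^-1 *: (x + y)) = 4^-1 * N (x + y).
  have := si_expand (- 2^-1) (si0 H) (siD Lx Ly).
  rewrite !ip0l ?mulr0//; try exact: (si0 H); last exact: siD.
  rewrite sub0r scaleNr opprK => ->.
  rewrite /= subr0 add0r; congr (_ * _).
  have -> : (- 2^-1 : C) = (- 2^-1)%:C%C by rewrite rmorphN fmorphV rmorph_nat.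
  by rewrite /sqnorm /=; field.
have -> : N (x + y) = N x + 2 * Re (ip x y) + N y.
  have := si_expand (-1) Lx Ly; rewrite scaleN1r opprK => ->.
  have -> : conjc (-1) = -1 :> C by apply/eqP; rewrite eq_complex /= !oppr0 !eqxx.
  rewrite mulN1r; case: (ip x y) => b c /=.
  by rewrite /sqnorm /= oppr0 expr0n sqrrN expr1n addr0; ring.
by field.
Qed.

Lemma si_cauchy_schwarz x y : L x -> L y -> sqnorm (ip x y) <= N x * N y.
Proof.
move=> Lx Ly; apply: discriminant_bound.
- exact: sqnorm_ge0.
- exact: (si_ge0 H).
move=> t.
have := si_ge0 H (siB Lx (siZ (t%:C%C * ip x y) Ly)).
rewrite si_expand//.
case: (ip x y) => b c; rewrite /sqnorm /= => h.
by apply: le_trans h _; rewrite le_eqVlt; apply/orP; left; apply/eqP; ring.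
Qed.

Lemma si_null_l x y : L x -> L y -> N x = 0 -> ip x y = 0.
Proof.
move=> Lx Ly x0; apply/sqnorm_eq0/eqP; rewrite eq_le sqnorm_ge0 andbT.
by have := si_cauchy_schwarz Lx Ly; rewrite x0 mul0r.
Qed.

(** Membership in the closure of M for the seminorm of the form. *)
Definition adherent (M : V -> Prop) (x : V) : Prop :=
  forall e, 0 < e -> exists2 u, M u & N (u - x) <= e.

Lemma adherent_orth (M : V -> Prop) x v : (forall u, M u -> L u) ->
  L x -> L v -> adherent M x -> (forall u, M u -> ip u v = 0) -> ip x v = 0.
Proof.
move=> ML Lx Lv ax Mv; apply/sqnorm_eq0/eqP; rewrite eq_le sqnorm_ge0 andbT.
apply/ler_addgt0Pr => e e0; rewrite add0r.
have Nv := si_ge0 H Lv.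
have [u Mu Nu] := ax (e / (N v + 1)) (divr_gt0 e0 (ltr_wpDl Nv ltr01)).
have Lu := ML _ Mu.
have -> : ip x v = - ip (u - x) v by rewrite ipBl// (Mv u)// sub0r opprK.
have -> : sqnorm (- ip (u - x) v) = sqnorm (ip (u - x) v).
  by rewrite /sqnorm; case: (ip _ _) => ? ? /=; rewrite !sqrrN.
apply: le_trans (si_cauchy_schwarz (siB Lu Lx) Lv) _.
apply: le_trans (ler_wpM2r Nv Nu) _.
by rewrite mulrAC ler_pdivrMr ?ltr_wpDl// ler_pM2l// lerDl.
Qed.

Hypothesis complete : forall u_ : nat -> V, (forall k, L (u_ k)) ->
  (forall e, 0 < e -> exists K, forall k l, (K <= k)%N -> (K <= l)%N ->
     N (u_ k - u_ l) <= e) ->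
  exists2 g, L g & forall e, 0 < e -> exists K, forall k, (K <= k)%N ->
     N (u_ k - g) <= e.

(** A sequence g_k in M whose squared distances to f tend to their infimum d is
    Cauchy by the parallelogram identity, because midpoints of M are at squared
    distance at least d.  Its limit g satisfies the orthogonality relation
    because moving g_k along u cannot go below d, so that the squared modulus
    of [ip (f - g_k) u] is at most [N u / (k + 1)]. *)
Lemma si_projection (M : V -> Prop) f : (forall u, M u -> L u) -> M 0 ->
  (forall a x y, M x -> M y -> M (a *: x + y)) -> L f ->
  exists g, [/\ L g, adherent M g & forall u, M u -> ip (f - g) u = 0].
Proof.
move=> ML M0 Mlin Lf.
pose D := [set N (f - u) | u in [set u | M u]]%classic.
have D0 : has_inf D.
  split; first by exists (N (f - 0)), 0.
  by exists 0 => _ [u Mu <-]; apply: (si_ge0 H); apply: siB => //; exact: ML.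
pose d := inf D.
have dle u : M u -> d <= N (f - u).
  by move=> Mu; apply: ge_inf; [exact: D0.2 | exists u].
have /choice[g_ g_P] : forall k : nat, exists u, M u /\ N (f - u) < d + k.+1%:R^-1.
  move=> k.
  have k0 : 0 < k.+1%:R^-1 :> R by rewrite invr_gt0.
  have [_ [u Mu <-] ?] := inf_adherent k0 D0.
  by exists u.
have Lg k : L (g_ k) by exact: ML (g_P k).1.
have cauchy_bound k l :
    N (g_ k - g_ l) <= 2 * k.+1%:R^-1 + 2 * l.+1%:R^-1.
  have Lk := siB Lf (Lg k); have Ll := siB Lf (Lg l).
  have := si_parallelogram Ll Lk.
  have -> : f - g_ l - (f - g_ k) = g_ k - g_ l.
    by rewrite opprB addrC addrA subrK.
  have -> : 2^-1 *: (f - g_ l + (f - g_ k)) = f - 2^-1 *: (g_ l + g_ k).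
    rewrite addrACA scalerDr -opprD scalerN; congr (_ - _).
    have {1 2}-> : f = 1 *: f by rewrite scale1r.
    by rewrite -scalerDl scalerA mulVf ?scale1r ?pnatr_eq0.
  have : d <= N (f - 2^-1 *: (g_ l + g_ k)).
    apply: dle; rewrite -(addr0 (2^-1 *: _)); apply: (Mlin _ _ _ _ M0).
    by rewrite -(scale1r (g_ l)); apply: Mlin; exact: (g_P _).1.
  have := (g_P k).2; have := (g_P l).2.
  move: (N (f - g_ l)) (N (f - g_ k)) (N (f - _)) (N (g_ k - g_ l)) => p q r s.
  move: (_^-1) (_^-1) => ? ?; lra.
have small e : 0 < e -> exists K, forall k, (K <= k)%N -> k.+1%:R^-1 <= e :> R.
  move=> e0; have [K _ HK] := near_infty_natSinv_lt (PosNum e0).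
  by exists K => k Kk; apply/ltW; exact: HK.
have [|g Lgg g_g] := complete Lg.
  move=> e e0; have [|K HK] := small (e / 4); first by rewrite divr_gt0.
  exists K => k l Kk Kl; apply: le_trans (cauchy_bound k l) _.
  by move: (HK _ Kk) (HK _ Kl); move: (k.+1%:R^-1) (l.+1%:R^-1) => ? ?; lra.
exists g; split=> //.
  move=> e e0; have [K HK] := g_g _ e0.
  by exists (g_ K); [exact: (g_P K).1 | exact: HK].
move=> u Mu; have Lu := ML _ Mu; have Nu := si_ge0 H Lu.
apply/sqnorm_eq0/eqP; rewrite eq_le sqnorm_ge0 andbT.
apply/ler_addgt0Pr => e e0; rewrite add0r.
pose e' := e / (4 * (N u + 1)).
have e'0 : 0 < e' by rewrite divr_gt0// mulr_gt0// ltr_wpDl.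
have [K1 HK1] := small _ e'0; have [K2 HK2] := g_g _ e'0.
pose k := maxn K1 K2.
have Lk := siB Lf (Lg k); have Lkg := siB (Lg k) Lgg.
have -> : f - g = (f - g_ k) + (g_ k - g) by rewrite addrA subrK.
rewrite ipDl//; apply: le_trans (sqnormD _ _) _.
(* N (f - g_k) is within 1 / (k + 1) of the infimum, and moving along any
   complex multiple of u does not go below it. *)
have le1 : sqnorm (ip (f - g_ k) u) <= k.+1%:R^-1 * N u.
  apply: discriminant_bound => //; first exact: sqnorm_ge0.
  move=> t; set z := ip _ _.
  have : d <= N (f - g_ k - (t%:C%C * z) *: u).
    rewrite -addrA -opprD; apply: dle; rewrite addrC.
    by apply: Mlin => //; exact: (g_P k).1.
  rewrite si_expand// -/z.
  have := (g_P k).2.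
  have -> : Re (conjc (t%:C%C * z) * z) = t * sqnorm z.
    by rewrite /sqnorm; case: z => b c /=; ring.
  have -> : sqnorm (t%:C%C * z) = t ^+ 2 * sqnorm z.
    by rewrite /sqnorm; case: z => b c /=; ring.
  by move: (k.+1%:R^-1) (N (f - g_ k)) (sqnorm z) (N u) => ? ? ? ?; lra.
have le2 := si_cauchy_schwarz Lkg Lu.
have le1' := le_trans le1 (ler_wpM2r Nu (HK1 k (leq_maxl _ _))).
have le2' := le_trans le2 (ler_wpM2r Nu (HK2 k (leq_maxr _ _))).
have : 4 * (e' * N u) <= e.
  have -> : e = 4 * (e' * (N u + 1)) by rewrite /e'; field; lra.
  by rewrite ler_pM2l// ler_pM2l// lerDl.
lra.
Qed.

End pre_hilbert.

(** * Completeness of real L2 *)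

Section square_integrable.
Context d (T : measurableType d) (R : realType) (mu : probability T R).
Implicit Types f g : T -> R.

Lemma Lfun_measurable p f : f \in Lfun mu p -> measurable_fun setT f.
Proof. by case/andP; rewrite inE. Qed.

(** Square-integrability by the integral of the square, instead of the
    norm with its real exponents. *)
Lemma Lfun2P f : f \in Lfun mu 2%:E <->
  measurable_fun setT f /\ (\int[mu]_x (f x ^+ 2)%:E < +oo)%E.
Proof.
split=> [f2|[mf f2]].
  split; first exact: Lfun_measurable f2.
  exact: integrable_lty (Lfun2_integrable_sqr f2).
apply/andP; split; rewrite inE//= /finite_norm unlock.
rewrite poweR_lty//=.
under eq_integral => x _ do rewrite -[2]/(2%:R) powR_mulrn// -normrX ger0_norm ?sqr_ge0//.
by [].
Qed.

Lemma Lfun_lin p (a : R) f g : (1 <= p)%E ->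
  f \in Lfun mu p -> g \in Lfun mu p -> (fun x => a * f x + g x) \in Lfun mu p.
Proof. by move=> p1 fp gp; exact: ((Lfun_submod_closed mu p1).2 a f g fp gp). Qed.

Lemma Lfun2B f g : f \in Lfun mu 2%:E -> g \in Lfun mu 2%:E ->
  (fun x => f x - g x) \in Lfun mu 2%:E.
Proof.
have h : (1 <= 2%:E :> \bar R)%E by rewrite lee_fin ler1n.
move=> f2 g2; have := Lfun_lin (-1) h g2 f2.
by under eq_fun do rewrite mulN1r addrC.
Qed.

Lemma Rintegral_sqrE f : f \in Lfun mu 2%:E ->
  (\int[mu]_x (f x ^+ 2))%:E = (\int[mu]_x (f x ^+ 2)%:E)%E.
Proof.
by move=> f2; rewrite /Rintegral fineK//; apply: integrable_fin_num => //;
  exact: Lfun2_integrable_sqr.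
Qed.

Lemma cvgn_of_variation (u : R^nat) :
  (\sum_(j <oo) `|u j.+1 - u j|%:E < +oo)%E -> cvgn u.
Proof.
move=> V.
have cs : cvgn (series (telescope u)).
  apply: normed_cvg => /=.
  apply: nondecreasing_is_cvgn.
    by apply: nondecreasing_series => k _ _; exact: normr_ge0.
  exists (fine (\sum_(j <oo) `|u j.+1 - u j|%:E)) => _ [n _ <-].
  rewrite -lee_fin fineK; last first.
    by rewrite ge0_fin_numE// nneseries_ge0// => k _ _; rewrite lee_fin.
  rewrite /= seriesEnat/= -sumEFin.
  by apply: nneseries_lim_ge => k _ _; rewrite lee_fin.
have -> : u = (fun n => u 0%N + series (telescope u) n).
  by apply/funext => n; rewrite -eq_sum_telescope.
exact: is_cvgD (is_cvg_cst _) cs.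
Qed.

Lemma limn_einf_le (u : (\bar R)^nat) (e : \bar R) K :
  (forall n, (K <= n)%N -> (u n <= e)%E) -> (limn_einf u <= e)%E.
Proof.
move=> ue; rewrite limn_einf_lim; apply: lime_le; first exact: is_cvg_einfs.
apply: nearW => n; apply: le_trans (ue (maxn n K) (leq_maxr _ _)).
by apply: ereal_inf_lbound; exists (maxn n K) => //=; rewrite leq_maxl.
Qed.

(** Riesz-Fischer.  Along a subsequence the consecutive differences have
    squared norm at most [4 ^- j]; on a probability space the sum of their
    absolute values is then integrable, hence finite almost everywhere, so the
    subsequence converges almost everywhere.  Fatou's lemma turns the Cauchy
    bound into convergence in norm to that limit. *)
Lemma Lfun2_complete (f_ : (T -> R)^nat) :
  (forall k, f_ k \in Lfun mu 2%:E) ->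
  (forall e, 0 < e -> exists K, forall k l, (K <= k)%N -> (K <= l)%N ->
     \int[mu]_x ((f_ k x - f_ l x) ^+ 2) <= e) ->
  exists2 g, g \in Lfun mu 2%:E & forall e, 0 < e -> exists K,
    forall k, (K <= k)%N -> \int[mu]_x ((f_ k x - g x) ^+ 2) <= e.
Proof.
move=> f2 cauchy.
have mf k : measurable_fun setT (f_ k) by exact: Lfun_measurable (f2 k).
have fB k l : (fun x => f_ k x - f_ l x) \in Lfun mu 2%:E by exact: Lfun2B.
have /choice[K_ K_P] : forall j : nat, exists K, forall k l,
    (K <= k)%N -> (K <= l)%N ->
    \int[mu]_x ((f_ k x - f_ l x) ^+ 2) <= (2 ^ j)%:R^-1 ^+ 2.
  by move=> j; apply: cauchy; rewrite exprn_gt0// invr_gt0 ltr0n expn_gt0.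
(* The maximum makes the indices nondecreasing; adding j makes them tend to
   infinity, which is needed to pass to the limit along the subsequence. *)
pose n_ j := (\max_(i < j.+1) K_ i + j)%N.
have Kn j : (K_ j <= n_ j)%N by apply: leq_trans (leq_addr _ _); exact: (leq_bigmax (Ordinal (ltnSn j))).
have nS j : (n_ j <= n_ j.+1)%N by rewrite /n_ leq_add// [leqRHS]big_ord_recr leq_maxl.
pose u j := f_ (n_ j).
have mu_ j : measurable_fun setT (u j) by exact: mf.
have mu2 i j : measurable_fun setT (fun x => u i x - u j x).
  exact: measurable_funB.
have mu3 i j : measurable_fun setT (fun x => (u i x - u j x) ^+ 2).
  exact: measurable_funX.
pose v j x := `|u j.+1 x - u j x|.
have v0 j x : 0 <= v j x by exact: normr_ge0.
have mv j : measurable_fun setT (v j).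
  exact: measurableT_comp.
have mS : measurable_fun setT (fun x => \sum_(j <oo) (v j x)%:E)%E.
  apply: ge0_emeasurable_sum => [k x _ _|k _]; first by rewrite lee_fin normr_ge0.
  exact/measurable_EFinP.
have intv j : (\int[mu]_x (v j x)%:E <= (4 / (2 ^ j.+1)%:R)%:E)%E.
  pose c : R := (2 ^ j)%:R.
  have c0 : 0 < c by rewrite ltr0n expn_gt0.
  have le1 : (\int[mu]_x (v j x)%:E <=
      \int[mu]_x (c * (u j.+1 x - u j x) ^+ 2 + c^-1)%:E)%E.
    apply: ge0_le_integral => //.
    - by move=> x _; rewrite lee_fin.
    - exact/measurable_EFinP.
    - apply/measurable_EFinP; apply: measurable_funD => //.
      exact: measurable_funM.
    (* With [c = 2 ^ j], [z <= c z^2 + 1 / c] trades the L1 norm for the square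
       of the L2 norm. *)
    - move=> x _; rewrite lee_fin /v; set y := _ - _.
      rewrite -[in leRHS]real_normK ?num_real//; set z := `|y|.
      have z0 : 0 <= z by exact: normr_ge0.
      have : 0 <= (c * z - 1) ^+ 2 / c by rewrite divr_ge0 ?sqr_ge0 ?ltW.
      have -> : (c * z - 1) ^+ 2 / c = (c * z ^+ 2 + c^-1) - 2 * z by field; lra.
      lra.
  apply: le_trans le1 _.
  under eq_integral do rewrite EFinD EFinM.
  rewrite ge0_integralD//; last 3 first.
  - by move=> x _; rewrite lee_fin mulr_ge0 ?sqr_ge0 ?ltW.
  - apply/measurable_EFinP; exact: measurable_funM.
  - by move=> x _; rewrite lee_fin invr_ge0 ltW.
  rewrite ge0_integralZl//; last 3 first.
  - exact/measurable_EFinP.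
  - by move=> x _; rewrite lee_fin sqr_ge0.
  - by rewrite lee_fin ltW.
  have -> : (\int[mu]_x c^-1%:E = c^-1%:E)%E.
    by rewrite integral_cst//= probability_setT mule1.
  rewrite -(@Rintegral_sqrE (fun x => u j.+1 x - u j x)) ?fB//.
  rewrite -EFinM -EFinD lee_fin.
  have := K_P j _ _ (leq_trans (Kn j) (nS j)) (Kn j).
  rewrite -/c => h.
  apply: le_trans (lerD (ler_wpM2l (ltW c0) h) (lexx _)) _.
  by rewrite expnS natrM -/c le_eqVlt; apply/orP; left; apply/eqP; field; lra.
have intS : (\int[mu]_x (\sum_(j <oo) (v j x)%:E) < +oo)%E.
  rewrite integral_nneseries//.
  - apply: le_lt_trans (ltry (4 : R)).
    apply: le_trans (@epsilon_trick0 R 4 xpredT _) => //.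
    by apply: lee_nneseries => // j _ _; apply: integral_ge0 => x _; rewrite lee_fin.
  - by move=> j; exact/measurable_EFinP.
  - by move=> j x _; rewrite lee_fin.
have S0 x : (0 <= \sum_(j <oo) (v j x)%:E)%E.
  by apply: nneseries_ge0 => *; rewrite lee_fin normr_ge0.
pose E := [set x | (\sum_(j <oo) (v j x)%:E)%E \is a fin_num].
have mE : measurable E.
  by have := emeasurable_fin_num measurableT mS; rewrite setTI.
have aeE : {ae mu, forall x, E x}.
  have : mu.-integrable setT (fun x => \sum_(j <oo) (v j x)%:E)%E.
    apply/integrableP; split => //.
    by under eq_integral => x _ do rewrite gee0_abs//.
  move/(integrable_ae measurableT); apply: filterS => x; exact.
(* Cutting off by the set of finite variation makes the sequence converge
   everywhere, which gives a measurable limit. *)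
pose w j x := u j x * \1_E x.
have mw j : measurable_fun setT (w j) by apply: measurable_funM.
have cw x : cvgn (w ^~ x).
  have [Ex|nEx] := pselect (E x).
    have -> : w ^~ x = u ^~ x.
      by apply/funext => j; rewrite /w indicE mem_set// mulr1.
    by apply: cvgn_of_variation; move: Ex; rewrite /E/= ge0_fin_numE.
  have -> : w ^~ x = cst 0.
    by apply/funext => j; rewrite /w indicE memNset// mulr0.
  exact: is_cvg_cst.
pose g x := limn (w ^~ x).
have mg : measurable_fun setT g.
  by apply: (measurable_fun_cvg mw) => x _; exact: cw.
have key e K : (forall k l, (K <= k)%N -> (K <= l)%N ->
    \int[mu]_x ((f_ k x - f_ l x) ^+ 2) <= e) ->
  forall k, (K <= k)%N -> (\int[mu]_x ((f_ k x - g x) ^+ 2)%:E <= e%:E)%E.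
  move=> HK k Kk.
  have -> : (\int[mu]_x ((f_ k x - g x) ^+ 2)%:E =
      \int[mu]_x limn_einf (fun j => ((f_ k x - w j x) ^+ 2)%:E))%E.
    apply: eq_integral => x _; apply/esym.
    have : (((f_ k x - w j x) ^+ 2)%:E @[j --> \oo] --> ((f_ k x - g x) ^+ 2)%:E)%E.
      apply: cvg_EFin; first by apply: nearW.
      apply: (@cvg_comp _ _ _ (fun j => f_ k x - w j x) (fun y : R => y ^+ 2) _ (nbhs (f_ k x - g x))).
        by apply: cvgB; [exact: cvg_cst | exact: cw].
      exact: exprn_continuous.
    by move=> h; have [-> _] := cvg_limn_einf_sup h.
  apply: le_trans (fatou _ _ _ _) _ => //.
  - move=> j; apply/measurable_EFinP; apply: measurable_funX.
    exact: measurable_funB.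
  - by move=> j x _; rewrite lee_fin sqr_ge0.
  apply: (@limn_einf_le _ _ K) => j Kj.
  have -> : (\int[mu]_x ((f_ k x - w j x) ^+ 2)%:E =
      \int[mu]_x ((f_ k x - u j x) ^+ 2)%:E)%E.
    apply: ge0_ae_eq_integral => //.
    - apply/measurable_EFinP; apply: measurable_funX.
      exact: measurable_funB.
    - apply/measurable_EFinP; apply: measurable_funX.
      exact: measurable_funB.
    - by move=> x _; rewrite lee_fin sqr_ge0.
    - by move=> x _; rewrite lee_fin sqr_ge0.
    - by apply: filterS aeE => x Ex _; rewrite /w indicE mem_set// mulr1.
  rewrite -(@Rintegral_sqrE (fun x => f_ k x - u j x)) ?fB// lee_fin.
  by apply: HK => //; apply: leq_trans Kj _; rewrite /n_ leq_addl.
have [K1 HK1] := cauchy 1 ltr01.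
have h2 k : (K1 <= k)%N -> (fun x => f_ k x - g x) \in Lfun mu 2%:E.
  move=> Kk; apply/Lfun2P; split; first exact: measurable_funB.
  exact: le_lt_trans (key _ _ HK1 _ Kk) (ltry _).
have g2 : g \in Lfun mu 2%:E.
  have := Lfun2B (f2 K1) (h2 K1 (leqnn _)).
  by under eq_fun do rewrite subKr.
exists g => // e e0; have [K HK] := cauchy e e0.
exists K => k Kk; rewrite -lee_fin.
rewrite (@Rintegral_sqrE (fun x => f_ k x - g x)) ?Lfun2B//.
exact: key HK k Kk.
Qed.

End square_integrable.

(** * Complex Lp functions on the circle *)

Section bounded.
Context d (T : measurableType d) (R : realType) (mu : probability T R).
Implicit Types f g : T -> R.

Lemma finite_norm2P f :
  finite_norm mu 2%:E f <-> (\int[mu]_x (f x ^+ 2)%:E < +oo)%E.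
Proof.
rewrite /finite_norm unlock.
under eq_integral => x _ do
  rewrite poweR_EFin -[2]/(2%:R) powR_mulrn// -normrX ger0_norm ?sqr_ge0//.
split=> [|h]; last exact: poweR_lty.
by apply: lty_poweRy; rewrite invr_neq0.
Qed.

Lemma finite_normyP f : finite_norm mu +oo%E f <->
  exists K, \forall x \ae mu, `|f x| <= K.
Proof.
have mu0 : (0 < mu [set: T])%E by rewrite probability_setT lte01.
rewrite /finite_norm unlock mu0; split=> [|[K fK]].
  have -> : abse \o (EFin \o f) = EFin \o (fun x => `|f x|) by [].
  by move/ess_supr_bounded.
apply: le_lt_trans (ltry K); apply/ess_supP.
by apply: filterS fK => x; rewrite /= lee_fin.
Qed.

Lemma LfunyP f : f \in Lfun mu +oo%E <->
  measurable_fun setT f /\ exists K, \forall x \ae mu, `|f x| <= K.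
Proof.
split=> [/andP[]|[mf fK]].
  by rewrite !inE /= => mf /finite_normyP.
by apply/andP; split; rewrite inE//=; exact/finite_normyP.
Qed.

Lemma LfunyM2 f g : f \in Lfun mu +oo%E -> g \in Lfun mu 2%:E ->
  (fun x => f x * g x) \in Lfun mu 2%:E.
Proof.
move=> /LfunyP[mf [K fK]] /Lfun2P[mg g2]; apply/Lfun2P; split.
  exact: measurable_funM.
have mg2 : measurable_fun setT (fun x => (g x ^+ 2)%:E).
  by apply/measurable_EFinP; exact: measurable_funX.
have K2 : 0 <= K ^+ 2 by rewrite sqr_ge0.
have le1 : (\int[mu]_x ((f x * g x) ^+ 2)%:E <=
    \int[mu]_x ((K ^+ 2)%:E * (g x ^+ 2)%:E))%E.
  apply: ae_ge0_le_integral => //.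
  - by move=> x _; rewrite lee_fin sqr_ge0.
  - by apply/measurable_EFinP; apply: measurable_funX; exact: measurable_funM.
  - by move=> x _; rewrite -EFinM lee_fin mulr_ge0// sqr_ge0.
  - exact: measurable_funeM.
  - apply: filterS fK => x fx _; rewrite -EFinM lee_fin exprMn.
    rewrite ler_wpM2r ?sqr_ge0// -[f x ^+ 2]real_normK ?num_real//.
    by rewrite ler_sqr ?nnegrE// (le_trans _ fx).
apply: le_lt_trans le1 _; rewrite ge0_integralZl//.
- by rewrite lte_mul_pinfty.
- by move=> x _; rewrite lee_fin sqr_ge0.
Qed.

Lemma LfunyMy f g : f \in Lfun mu +oo%E -> g \in Lfun mu +oo%E ->
  (fun x => f x * g x) \in Lfun mu +oo%E.
Proof.
move=> /LfunyP[mf [K fK]] /LfunyP[mg [L gL]]; apply/LfunyP; split.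
  exact: measurable_funM.
exists (K * L); apply: filterS2 fK gL => x fK gL.
by rewrite normrM ler_pM.
Qed.

Lemma Lfuny_sub2 f : f \in Lfun mu +oo%E -> f \in Lfun mu 2%:E.
Proof.
apply: Lfun_subset => //; rewrite ?lee_fin ?ler1n ?leey//.
exact: fin_num_measure.
Qed.

End bounded.

Section complex_Lp.
Variable R : realType.
Local Notation C := R[i].
Local Notation m := (@circle_measure R).
Local Notation Re := complex.Re.
Local Notation Im := complex.Im.
Implicit Types (f g : circle R -> C) (p : \bar R).

(** Membership by real and imaginary parts gives access to the linear theory
    of real Lp functions. *)
Definition cLp p f : Prop :=
  (fun w => Re (f w)) \in Lfun m p /\ (fun w => Im (f w)) \in Lfun m p.

Lemma Lfun_cst0 p : (1 <= p)%E -> (fun=> 0) \in Lfun m p.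
Proof. by move=> p1; exact: ((Lfun_submod_closed m p1).1). Qed.

Lemma LfunD p (u v : circle R -> R) : (1 <= p)%E ->
  u \in Lfun m p -> v \in Lfun m p -> (fun w => u w + v w) \in Lfun m p.
Proof.
by move=> p1 u1 v1; have := Lfun_lin 1 p1 u1 v1; under eq_fun do rewrite mul1r.
Qed.

Lemma LfunN p (u : circle R -> R) : (1 <= p)%E ->
  u \in Lfun m p -> (fun w => - u w) \in Lfun m p.
Proof.
move=> p1 u1; have := Lfun_lin (-1) p1 u1 (Lfun_cst0 p1).
by under eq_fun do rewrite mulN1r addr0.
Qed.

Lemma complex_ReD (a b : C) : Re (a + b) = Re a + Re b.
Proof. by case: a b => ? ? []. Qed.
Lemma complex_ImD (a b : C) : Im (a + b) = Im a + Im b.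
Proof. by case: a b => ? ? []. Qed.
Lemma complex_ReM (a b : C) : Re (a * b) = Re a * Re b - Im a * Im b.
Proof. by case: a b => ? ? []. Qed.
Lemma complex_ImM (a b : C) : Im (a * b) = Re a * Im b + Im a * Re b.
Proof. by case: a b => ? ? []. Qed.

Lemma cLpD p f g : (1 <= p)%E -> cLp p f -> cLp p g -> cLp p (fun w => f w + g w).
Proof.
move=> p1 [fr fi] [gr gi]; split.
  by under eq_fun do rewrite complex_ReD; exact: LfunD.
by under eq_fun do rewrite complex_ImD; exact: LfunD.
Qed.

Lemma cLp0 p : (1 <= p)%E -> cLp p (fun=> 0).
Proof. by move=> p1; split; exact: Lfun_cst0. Qed.

Lemma cLp_sum p I (s : seq I) (F : I -> circle R -> C) : (1 <= p)%E ->
  (forall i, cLp p (F i)) -> cLp p (fun w => \sum_(i <- s) F i w).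
Proof.
move=> p1 Fp; elim: s => [|i s IH].
  by under eq_fun do rewrite big_nil; exact: cLp0.
by under eq_fun do rewrite big_cons; exact: cLpD.
Qed.

Lemma cLp_conj p f : (1 <= p)%E -> cLp p f -> cLp p (fun w => conjc (f w)).
Proof.
move=> p1 [fr fi]; split.
  by rewrite (_ : (fun _ => _) = (fun w => Re (f w)))//; apply/funext => w; case: (f w).
rewrite (_ : (fun _ => _) = (fun w => - Im (f w))); first exact: LfunN.
by apply/funext => w; case: (f w).
Qed.

Lemma cLpM p q r f g : (1 <= r)%E ->
  (forall u v : circle R -> R, u \in Lfun m p -> v \in Lfun m q ->
     (fun w => u w * v w) \in Lfun m r) ->
  cLp p f -> cLp q g -> cLp r (fun w => f w * g w).
Proof.
move=> r1 H [fr fi] [gr gi]; split.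
  under eq_fun do rewrite complex_ReM; apply: LfunD => //; first exact: H.
  by apply: LfunN => //; exact: H.
by under eq_fun do rewrite complex_ImM; apply: LfunD => //; exact: H.
Qed.

Lemma le1y : (1 <= +oo :> \bar R)%E. Proof. exact: leey. Qed.
Lemma le12 : (1 <= 2%:E :> \bar R)%E. Proof. by rewrite lee_fin ler1n. Qed.
#[local] Hint Resolve le1y le12 : core.

Lemma cLp2M f g : cLp 2%:E f -> cLp 2%:E g -> cLp 1 (fun w => f w * g w).
Proof. by apply: cLpM => // u v; exact: Lfun2_mul_Lfun1. Qed.

Lemma cLpyM2 f g : cLp +oo%E f -> cLp 2%:E g -> cLp 2%:E (fun w => f w * g w).
Proof. by apply: cLpM => // u v; exact: LfunyM2. Qed.

Lemma cLpyMy f g : cLp +oo%E f -> cLp +oo%E g -> cLp +oo%E (fun w => f w * g w).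
Proof. by apply: cLpM => // u v; exact: LfunyMy. Qed.

Lemma cLpy2 f : cLp +oo%E f -> cLp 2%:E f.
Proof. by case=> ? ?; split; exact: Lfuny_sub2. Qed.

Lemma cLp21 f : cLp 2%:E f -> cLp 1 f.
Proof.
by case=> ? ?; split; apply: Lfun_subset12 => //; exact: fin_num_measure.
Qed.

Lemma cLp_cst p (c : C) : (1 <= p)%E -> cLp p (fun=> c).
Proof.
move=> p1; have cy : cLp +oo%E (fun=> c).
  by split; apply/LfunyP; split => //; [exists `|Re c| | exists `|Im c|]; exact: nearW.
by case: cy => a b; split; apply: (Lfun_subset p1 le1y) => //;
  rewrite ?leey//; exact: fin_num_measure.
Qed.

Lemma cLpZ p (c : C) f : (1 <= p)%E -> cLp p f -> cLp p (fun w => c * f w).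
Proof.
move=> p1 [fr fi]; split.
  under eq_fun do rewrite complex_ReM -mulNr.
  by apply: Lfun_lin => //; have := Lfun_lin (- Im c) p1 fi (Lfun_cst0 p1);
    under eq_fun do rewrite addr0.
under eq_fun do rewrite complex_ImM.
by apply: Lfun_lin => //; have := Lfun_lin (Im c) p1 fr (Lfun_cst0 p1);
    under eq_fun do rewrite addr0.
Qed.

(** For essentially bounded functions the norm of the definition is traded
    for bounds on the real and imaginary parts. *)
Lemma LpyE f : Lp +oo%E f <-> cLp +oo%E f.
Proof.
have nE (z : C) : Normc.normc z ^+ 2 = Re z ^+ 2 + Im z ^+ 2.
  by case: z => a b; rewrite /= sqr_sqrtr// addr_ge0// sqr_ge0.
have n0 (z : C) : 0 <= Normc.normc z by case: z => a b; exact: sqrtr_ge0.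
split=> [[[mr mi] /finite_normyP[K fK]]|[/LfunyP[mr [K fK]] /LfunyP[mi [L fL]]]].
  split; apply/LfunyP; split => //; exists K; apply: filterS fK => w;
    rewrite ger0_norm// => fK; apply: le_trans fK;
    rewrite -(@ler_pXn2r _ 2)// ?nnegrE// nE real_normK ?num_real//.
    by rewrite lerDl sqr_ge0.
  by rewrite lerDr sqr_ge0.
split; first by split.
apply/finite_normyP; exists (K + L); apply: filterS2 fK fL => w fK fL.
rewrite ger0_norm// -(@ler_pXn2r _ 2)// ?nnegrE//; last first.
  by rewrite addr_ge0// (le_trans _ fK, le_trans _ fL).
rewrite nE -[Re _ ^+ 2]real_normK ?num_real// -[Im _ ^+ 2]real_normK ?num_real//.
have := normr_ge0 (Re (f w)); have := normr_ge0 (Im (f w)).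
move: `|Re (f w)| `|Im (f w)| fK fL => a b aK bL b0 a0; nra.
Qed.

Lemma cLp_int f : cLp 1 f ->
  m.-integrable setT (EFin \o (fun w => Re (f w))) /\
  m.-integrable setT (EFin \o (fun w => Im (f w))).
Proof. by case=> /Lfun1_integrable ? /Lfun1_integrable ?. Qed.

Lemma cintegralD f g : cLp 1 f -> cLp 1 g ->
  cintegral (fun w => f w + g w) = cintegral f + cintegral g.
Proof.
move=> /cLp_int[fr fi] /cLp_int[gr gi]; rewrite /cintegral.
apply/eqP; rewrite eq_complex /=; apply/andP; split; apply/eqP.
  by rewrite -RintegralD//; apply: eq_Rintegral => w _; exact: complex_ReD.
by rewrite -RintegralD//; apply: eq_Rintegral => w _; exact: complex_ImD.
Qed.

Lemma cintegralZ c f : cLp 1 f ->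
  cintegral (fun w => c * f w) = c * cintegral f.
Proof.
move=> /cLp_int[fr fi]; rewrite /cintegral.
have iZ (a : R) u : m.-integrable setT (EFin \o u) ->
    m.-integrable setT (EFin \o (fun w => a * u w)).
  by move=> iu; exact: (integrableZl measurableT a iu).
apply/eqP; rewrite eq_complex complex_ReM complex_ImM /=; apply/andP; split; apply/eqP.
  rewrite -!RintegralZl// -RintegralB//; try exact: iZ.
  by apply: eq_Rintegral => w _; exact: complex_ReM.
rewrite -!RintegralZl// -RintegralD//; try exact: iZ.
by apply: eq_Rintegral => w _; exact: complex_ImM.
Qed.

Lemma cintegral0 : cintegral (fun=> 0 : C) = 0.
Proof. by rewrite /cintegral /= /Rintegral integral0. Qed.

Lemma cintegral_sum I (s : seq I) (F : I -> circle R -> C) :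
  (forall i, cLp 1 (F i)) ->
  cintegral (fun w => \sum_(i <- s) F i w) = \sum_(i <- s) cintegral (F i).
Proof.
move=> F1; elim: s => [|i s IH].
  by rewrite big_nil -[RHS]cintegral0; congr cintegral; apply/funext => w; rewrite big_nil.
rewrite big_cons -IH -cintegralD//; last exact: cLp_sum.
by congr cintegral; apply/funext => w; rewrite big_cons.
Qed.

Lemma cintegral_conj f : cLp 1 f ->
  cintegral (fun w => conjc (f w)) = conjc (cintegral f).
Proof.
move=> /cLp_int[fr fi]; rewrite /cintegral /conjc; congr Complex.
  by apply: eq_Rintegral => w _; case: (f w).
rewrite -mulN1r -RintegralZl//.
by apply: eq_Rintegral => w _; case: (f w) => ? ? /=; rewrite mulN1r.
Qed.

End complex_Lp.

#[local] Hint Resolve le1y le12 : core.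

(** * Vector-valued L2 on the circle *)

Section vector_L2.
Variables (R : realType) (n : nat).
Local Notation C := R[i].
Local Notation m := (@circle_measure R).
Local Notation Re := complex.Re.
Local Notation Im := complex.Im.
Local Notation V := (circle R -> 'cV[C]_n).
Implicit Types f g h : V.

Definition sqnormv (v : 'cV[C]_n) : R := \sum_i sqnorm (v i 0).

Lemma sqnormv_ge0 v : 0 <= sqnormv v.
Proof. by apply: sumr_ge0 => i _; exact: sqnorm_ge0. Qed.

Lemma sqnormv_eq0 v : sqnormv v = 0 -> v = 0.
Proof.
move=> /eqP; rewrite psumr_eq0 => [/allP v0|i _]; last exact: sqnorm_ge0.
apply/colP => i; rewrite mxE; apply/sqnorm_eq0/eqP/v0.
by rewrite mem_index_enum.
Qed.

Lemma enorm_sqr (v : 'cV[C]_n) : enorm v ^+ 2 = sqnormv v.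
Proof.
rewrite /enorm sqr_sqrtr; last by apply: sumr_ge0 => i _; rewrite sqr_ge0.
apply: eq_bigr => i _; case: (v i 0) => a b.
by rewrite /sqnorm /= sqr_sqrtr// addr_ge0// sqr_ge0.
Qed.

Lemma measurable_sqnormv f : (forall i, measurable_complex (fun w => f w i 0)) ->
  measurable_fun setT (fun w => sqnormv (f w)).
Proof.
move=> mf; apply: measurable_sum => i; have [mr mi] := mf i.
by apply: measurable_funD; exact: measurable_funX.
Qed.

Lemma integrable_sqnormv f : (forall i, cLp 2%:E (fun w => f w i 0)) ->
  m.-integrable setT (EFin \o (fun w => sqnormv (f w))).
Proof.
move=> f2; rewrite (_ : _ \o _ =
    (fun w => \sum_i ((Re (f w i 0) ^+ 2)%:E + (Im (f w i 0) ^+ 2)%:E))%E); last first.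
  by apply/funext => w /=; rewrite /sqnormv -sumEFin.
apply: integrable_sum => // i _; have [fr fi] := f2 i.
by apply: integrableD => //; exact: Lfun2_integrable_sqr.
Qed.

(** Being in L2 is a componentwise condition, so that products and sums can
    be treated entry by entry. *)
Lemma L2EP f : L2E f <-> forall i, cLp 2%:E (fun w => f w i 0).
Proof.
split=> [[mf /finite_norm2P]|f2].
  under eq_integral do rewrite enorm_sqr.
  move=> fin i; have [mr mi] := mf i.
  have msq : measurable_fun setT (fun w => (sqnormv (f w))%:E).
    by apply/measurable_EFinP; exact: measurable_sqnormv.
  have sq_le w : sqnorm (f w i 0) <= sqnormv (f w).
    rewrite /sqnormv (bigD1 i)//= lerDl sumr_ge0// => j _; exact: sqnorm_ge0.
  split; apply/Lfun2P; split => //; apply: le_lt_trans fin;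
    apply: ge0_le_integral => //.
  - by move=> w _; rewrite lee_fin sqr_ge0.
  - by apply/measurable_EFinP; exact: measurable_funX.
  - by move=> w _; rewrite lee_fin (le_trans _ (sq_le w))// lerDl sqr_ge0.
  - by move=> w _; rewrite lee_fin sqr_ge0.
  - by apply/measurable_EFinP; exact: measurable_funX.
  - by move=> w _; rewrite lee_fin (le_trans _ (sq_le w))// lerDr sqr_ge0.
split.
  by move=> i; have [/Lfun_measurable ? /Lfun_measurable ?] := f2 i; split.
apply/finite_norm2P; under eq_integral do rewrite enorm_sqr.
exact: integrable_lty (integrable_sqnormv f2).
Qed.

Lemma cLp_inner f g : L2E f -> L2E g ->
  forall i, cLp 1 (fun w => f w i 0 * conjc (g w i 0)).
Proof.
move=> /L2EP f2 /L2EP g2 i; apply: cLp2M => //.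
by apply: (@cLp_conj _ _ (fun w => g w i 0)).
Qed.

Lemma innerEE f g : L2E f -> L2E g ->
  innerE f g = \sum_i cintegral (fun w => f w i 0 * conjc (g w i 0)).
Proof. by move=> f2 g2; rewrite /innerE cintegral_sum//; exact: cLp_inner. Qed.

Lemma L2E_lin (a : C) f g : L2E f -> L2E g -> L2E (a *: f + g).
Proof.
move=> /L2EP f2 /L2EP g2; apply/L2EP => i.
rewrite (_ : (fun _ => _) = (fun w => a * f w i 0 + g w i 0)); last first.
  by apply/funext => w; rewrite !mxE.
by apply: cLpD => //; exact: cLpZ.
Qed.

Lemma ReinnerE f : Re (innerE f f) = \int[m]_w sqnormv (f w).
Proof.
rewrite /innerE /cintegral /=; apply: eq_Rintegral => w _.
rewrite (big_morph _ (@complex_ReD R) (erefl : Re (0 : C) = 0)).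
apply: eq_bigr => i _; rewrite /sqnorm; case: (f w i 0) => a b /=; ring.
Qed.

Lemma semi_innerE : semi_inner (V := V) (@L2E R n) (@innerE R n).
Proof.
split.
- apply/L2EP => i.
  rewrite (_ : (fun _ => _) = (fun=> 0)); last by apply/funext => w; rewrite !mxE.
  exact: cLp0.
- exact: L2E_lin.
- move=> a f g h f2 g2 h2; rewrite !innerEE//; last exact: L2E_lin.
  rewrite mulr_sumr -big_split/=; apply: eq_bigr => i _.
  rewrite -cintegralZ; last exact: cLp_inner.
  rewrite -cintegralD; [|exact/cLpZ/cLp_inner|exact: cLp_inner].
  by congr cintegral; apply/funext => w; rewrite !mxE; ring.
- move=> f g f2 g2; rewrite !innerEE// rmorph_sum; apply: eq_bigr => i _.
  apply: etrans (cintegral_conj (cLp_inner f2 g2 i)).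
  by congr cintegral; apply/funext => w; rewrite rmorphM/= conjcK mulrC.
- by move=> f _; rewrite ReinnerE; apply: Rintegral_ge0 => w _; exact: sqnormv_ge0.
Qed.

Lemma L2E_complete (u_ : nat -> V) : (forall k, L2E (u_ k)) ->
  (forall e, 0 < e -> exists K, forall k l, (K <= k)%N -> (K <= l)%N ->
     Re (innerE (u_ k - u_ l) (u_ k - u_ l)) <= e) ->
  exists2 g, L2E g & forall e, 0 < e -> exists K, forall k, (K <= k)%N ->
     Re (innerE (u_ k - g) (u_ k - g)) <= e.
Proof.
move=> u2 cauchy.
have uP k : forall i, cLp 2%:E (fun w => u_ k w i 0) by exact/L2EP.
have intsq f : L2E f -> m.-integrable setT (EFin \o (fun w => sqnormv (f w))).
  by move=> /L2EP; exact: integrable_sqnormv.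
have uB k l : L2E (u_ k - u_ l) by exact: (siB semi_innerE).
have cauchyRe i : exists2 g : circle R -> R, g \in Lfun m 2%:E &
    forall e, 0 < e -> exists K, forall k, (K <= k)%N ->
    \int[m]_w ((Re (u_ k w i 0) - g w) ^+ 2) <= e.
  apply: Lfun2_complete => [k|e e0]; first by have [] := uP k i.
  have [K HK] := cauchy e e0; exists K => k l Kk Kl.
  apply: le_trans (HK k l Kk Kl); rewrite ReinnerE; apply: le_Rintegral => //.
  - have [kr _] := uP k i; have [lr _] := uP l i.
    exact: (@Lfun2_integrable_sqr _ _ _ m (fun w => Re (u_ k w i 0) - Re (u_ l w i 0)) (Lfun2B kr lr)).
  - exact: intsq.
  - move=> w _; rewrite /sqnormv (bigD1 i)//= /sqnorm -addrA !mxE.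
    have -> : Re (u_ k w i 0 - u_ l w i 0) = Re (u_ k w i 0) - Re (u_ l w i 0).
      by case: (u_ k w i 0) (u_ l w i 0) => ? ? [].
    by rewrite lerDl addr_ge0 ?sqr_ge0 ?sumr_ge0// => j _; exact: sqnorm_ge0.
have cauchyIm i : exists2 g : circle R -> R, g \in Lfun m 2%:E &
    forall e, 0 < e -> exists K, forall k, (K <= k)%N ->
    \int[m]_w ((Im (u_ k w i 0) - g w) ^+ 2) <= e.
  apply: Lfun2_complete => [k|e e0]; first by have [] := uP k i.
  have [K HK] := cauchy e e0; exists K => k l Kk Kl.
  apply: le_trans (HK k l Kk Kl); rewrite ReinnerE; apply: le_Rintegral => //.
  - have [_ kr] := uP k i; have [_ lr] := uP l i.
    exact: (@Lfun2_integrable_sqr _ _ _ m (fun w => Im (u_ k w i 0) - Im (u_ l w i 0)) (Lfun2B kr lr)).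
  - exact: intsq.
  - move=> w _; rewrite /sqnormv (bigD1 i)//= /sqnorm -addrA !mxE.
    have -> : Im (u_ k w i 0 - u_ l w i 0) = Im (u_ k w i 0) - Im (u_ l w i 0).
      by case: (u_ k w i 0) (u_ l w i 0) => ? ? [].
    by rewrite addrCA lerDl addr_ge0 ?sqr_ge0 ?sumr_ge0// => j _; exact: sqnorm_ge0.
have /choice[gr grP] : forall i : 'I_n, exists g : circle R -> R, g \in Lfun m 2%:E /\
    forall e, 0 < e -> exists K, forall k, (K <= k)%N ->
    \int[m]_w ((Re (u_ k w i 0) - g w) ^+ 2) <= e.
  by move=> i; have [g ? ?] := cauchyRe i; exists g.
have /choice[gi giP] : forall i : 'I_n, exists g : circle R -> R, g \in Lfun m 2%:E /\
    forall e, 0 < e -> exists K, forall k, (K <= k)%N ->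
    \int[m]_w ((Im (u_ k w i 0) - g w) ^+ 2) <= e.
  by move=> i; have [g ? ?] := cauchyIm i; exists g.
pose g : V := fun w => \col_i Complex (gr i w) (gi i w).
have g2 : L2E g.
  apply/L2EP => i; split.
    by under eq_fun do rewrite mxE/=; exact: (grP i).1.
  by under eq_fun do rewrite mxE/=; exact: (giP i).1.
exists g => // e e0.
pose e' := e / (2 * n.+1%:R).
have n1 : 0 < n.+1%:R :> R by rewrite ltr0n.
have e'0 : 0 < e' by rewrite divr_gt0// mulr_gt0.
have /choice[Kr KrP] : forall i : 'I_n, exists K, forall k, (K <= k)%N ->
    \int[m]_w ((Re (u_ k w i 0) - gr i w) ^+ 2) <= e'.
  by move=> i; exact: (grP i).2.
have /choice[Ki KiP] : forall i : 'I_n, exists K, forall k, (K <= k)%N ->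
    \int[m]_w ((Im (u_ k w i 0) - gi i w) ^+ 2) <= e'.
  by move=> i; exact: (giP i).2.
exists (maxn (\max_i Kr i) (\max_i Ki i)) => k; rewrite geq_max => /andP[kr ki].
have fr i : (fun w => Re (u_ k w i 0) - gr i w) \in Lfun m 2%:E.
  by apply: Lfun2B; [have [] := uP k i | exact: (grP i).1].
have fi i : (fun w => Im (u_ k w i 0) - gi i w) \in Lfun m 2%:E.
  by apply: Lfun2B; [have [] := uP k i | exact: (giP i).1].
have -> : Re (innerE (u_ k - g) (u_ k - g)) =
    \sum_i (\int[m]_w ((Re (u_ k w i 0) - gr i w) ^+ 2) +
            \int[m]_w ((Im (u_ k w i 0) - gi i w) ^+ 2)).
  apply: EFin_inj.
  rewrite ReinnerE /Rintegral fineK; last first.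
    by apply: integrable_fin_num => //; apply: intsq; exact: (siB semi_innerE).
  rewrite -sumEFin.
  under eq_bigr => i _ do rewrite EFinD (@Rintegral_sqrE _ _ _ m _ (fr i)) (@Rintegral_sqrE _ _ _ m _ (fi i)).
  under eq_integral do rewrite /sqnormv -sumEFin.
  rewrite ge0_integral_sum//; last 2 first.
  - move=> i; apply/measurable_EFinP.
    have [kr' ki'] := (L2EP (u_ k - g)).1 (siB semi_innerE (u2 k) g2) i.
    by apply: measurable_funD; apply: measurable_funX; apply: Lfun_measurable; eassumption.
  - by move=> i w _; rewrite lee_fin sqnorm_ge0.
  apply: eq_bigr => i _.
  under eq_integral do rewrite /sqnorm EFinD.
  rewrite ge0_integralD//.
  - congr (_ + _)%E; apply: eq_integral => w _; rewrite !mxE.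
      by case: (u_ k w i 0).
    by case: (u_ k w i 0).
  - by move=> w _; rewrite lee_fin sqr_ge0.
  - apply/measurable_EFinP/measurable_funX.
    have [kr' ki'] := (L2EP (u_ k - g)).1 (siB semi_innerE (u2 k) g2) i.
    exact: Lfun_measurable kr'.
  - by move=> w _; rewrite lee_fin sqr_ge0.
  - apply/measurable_EFinP/measurable_funX.
    have [kr' ki'] := (L2EP (u_ k - g)).1 (siB semi_innerE (u2 k) g2) i.
    exact: Lfun_measurable ki'.
have -> : e = \sum_(i < n.+1) (e' + e').
  rewrite sumr_const card_ord -mulr_natr /e'; field; lra.
have e'ge0 := ltW e'0.
rewrite big_ord_recr/= -[leLHS]addr0; apply: lerD; last exact: addr_ge0.
apply: ler_sum => i _; apply: lerD.
  by apply: KrP; apply: leq_trans kr; exact: leq_bigmax.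
by apply: KiP; apply: leq_trans ki; exact: leq_bigmax.
Qed.

(** The null vectors of the form are the functions that vanish almost
    everywhere; this carries statements about the form over to almost
    everywhere statements. *)
Lemma innerE_null f : L2E f -> (Re (innerE f f) = 0 <-> f = cst 0 %[ae m]).
Proof.
move=> f2; have mf := measurable_sqnormv f2.1.
have mf' : measurable_fun setT (fun w => (sqnormv (f w))%:E) by exact/measurable_EFinP.
have intf : (\int[m]_w `|(sqnormv (f w))%:E| = (Re (innerE f f))%:E)%E.
  rewrite ReinnerE /Rintegral fineK; last first.
    rewrite ge0_fin_numE; last by apply: integral_ge0 => w _; rewrite lee_fin sqnormv_ge0.
    by apply: integrable_lty => //; exact: integrable_sqnormv ((L2EP f).1 f2).
  by apply: eq_integral => w _; rewrite gee0_abs// lee_fin sqnormv_ge0.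
have := ae_eq_integral_abs m measurableT mf'.
rewrite intf => -[H1 H2]; split=> [f0|f0].
  have := H1 (congr1 EFin f0); apply: filterS => w /(_ I) [] h _.
  exact: sqnormv_eq0.
apply: EFin_inj; apply: H2; apply: filterS f0 => w /(_ I) -> _ /=.
congr EFin; rewrite /sqnormv big1// => i _.
by rewrite mxE /sqnorm /= expr0n addr0.
Qed.

Lemma innerE_ael f g h : L2E f -> L2E g -> L2E h -> f = g %[ae m] ->
  innerE f h = innerE g h.
Proof.
move=> f2 g2 h2 fg; apply/eqP; rewrite -subr_eq0 -(ipBl semi_innerE)//.
apply/eqP; apply: (si_null_l semi_innerE) => //; first exact: (siB semi_innerE).
apply/innerE_null; first exact: (siB semi_innerE).
by apply: filterS fg => w /(_ I) E _; rewrite /= /GRing.add /= E subrr.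
Qed.

End vector_L2.

(** * Arc length on the circle and on the line *)

Section arc_length.
Variable R : realType.
Local Notation C := R[i].
Local Notation m := (@circle_measure R).
Local Notation mu := (@lebesgue_measure R).
Local Notation I := `[0%R, 2 * pi : R]%classic.
Local Notation Re := complex.Re.
Local Notation Im := complex.Im.

Lemma ge0_integral_circle (f : circle R -> \bar R) :
  measurable_fun setT f -> (forall w, 0 <= f w)%E ->
  (\int[m]_w f w = ((2 * pi)^-1)%:E * \int[mu]_(t in I) f (expi t))%E.
Proof.
move=> mf f0; rewrite /circle_measure ge0_integral_distribution//=.
rewrite integral_uniform/= ?subr0//.
by apply: measurableT_comp => //; exact: measurable_expi.
Qed.

Lemma measurable_circle_expi (f : circle R -> R) : measurable_fun setT f ->
  measurable_fun setT (fun t : measurableTypeR R => f (expi t)).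
Proof. by move=> mf; apply: (measurableT_comp mf); exact: measurable_expi. Qed.

Lemma integrable_circle (f : circle R -> R) :
  m.-integrable setT (EFin \o f) ->
  mu.-integrable I (EFin \o (fun t => f (expi t))).
Proof.
move=> /integrableP[/measurable_EFinP mf foo]; apply/integrableP; split.
  by apply/measurable_EFinP; apply: measurable_funTS; exact: measurable_circle_expi.
move: foo; rewrite ge0_integral_circle//; last first.
  by apply/measurable_EFinP; exact: measurableT_comp.
have c0 : (0 < ((2 * pi)^-1 : R)%:E)%E by rewrite lte_fin invr_gt0 mulr_gt0// pi_gt0.
rewrite [in X in X -> _]muleC -lte_pdivlMr ?lte_fin ?invr_gt0 ?mulr_gt0 ?pi_gt0//.
move=> h; apply: lt_le_trans h _; exact: leey.
Qed.

Lemma Rintegral_circle (f : circle R -> R) :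
  m.-integrable setT (EFin \o f) ->
  \int[m]_w f w = (2 * pi)^-1 * \int[mu]_(t in I) f (expi t).
Proof.
move=> intf; have intI := integrable_circle intf.
have mf : measurable_fun setT (EFin \o f) by case/integrableP: intf.
have c0 : 0 <= (2 * pi)^-1 :> R by rewrite invr_ge0 mulr_ge0// pi_ge0.
apply: EFin_inj; rewrite /Rintegral EFinM !fineK; last 2 first.
- by apply: integrable_fin_num.
- by apply: integrable_fin_num.
set g := fun t => f (expi t) in intI *.
pose P := (\int[mu]_(t in I) (EFin \o g)^\+ t)%E.
pose N := (\int[mu]_(t in I) (EFin \o g)^\- t)%E.
have PE : (\int[m]_w (EFin \o f)^\+ w = ((2 * pi)^-1)%:E * P)%E.
  rewrite (ge0_integral_circle (measurable_funepos mf) (funepos_ge0 _)).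
  by congr (_ * _)%E; apply: eq_integral => t _; rewrite !funeposE.
have NE : (\int[m]_w (EFin \o f)^\- w = ((2 * pi)^-1)%:E * N)%E.
  rewrite (ge0_integral_circle (measurable_funeneg mf) (funeneg_ge0 _)).
  by congr (_ * _)%E; apply: eq_integral => t _; rewrite !funenegE.
transitivity (((2 * pi)^-1)%:E * P - ((2 * pi)^-1)%:E * N)%E.
  by rewrite -PE -NE -integralE.
have -> : (\int[mu]_(t in I) (g t)%:E = P - N)%E by rewrite /P /N -integralE.
rewrite (@muleBr _ _ P N)// fin_num_adde_defr//.
exact: integrable_pos_fin_num.
Qed.

Lemma circle_measureE (A : set (circle R)) : measurable A ->
  (m A = ((2 * pi)^-1)%:E * mu (@expi R @^-1` A `&` I))%E.
Proof.
move=> mA; have := ge0_integral_circle (f := fun w => (\1_A w)%:E).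
rewrite integral_indic// setIT => ->//.
- congr (_ * _)%E; rewrite -integral_indic//.
  by rewrite -[_ @^-1` _]setTI; exact: measurable_expi.
- exact/measurable_EFinP.
Qed.

Lemma circle_negligible (A : set (circle R)) : measurable A ->
  m A = 0%E <-> mu (@expi R @^-1` A `&` I) = 0%E.
Proof.
move=> mA; rewrite circle_measureE//; split=> [/eqP|->]; last by rewrite mule0.
rewrite mule_eq0 => /orP[|/eqP//].
by rewrite eqe invr_eq0 gt_eqF// mulr_gt0// pi_gt0.
Qed.

Lemma lebesgue_measure_reflection (c : R) (A : set R) : measurable A ->
  mu ((fun t => c - t) @^-1` A) = mu A.
Proof.
move=> mA.
have mr : measurable_fun setT ((fun t => c - t) : measurableTypeR R -> measurableTypeR R).
  exact: measurable_funB.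
pose rf : {mfun measurableTypeR R >-> measurableTypeR R} :=
  @mfun_Sub _ _ (measurableTypeR R) (measurableTypeR R) (fun t => c - t) (mem_set mr).
have := @lebesgue_measure_unique R (pushforward mu rf).
move=> /(_ mr _ A mA) ->//.
move=> _ [[a b]] _ <- /=.
transitivity (mu `[c - b, c - a[%classic); last first.
  rewrite /pushforward; congr (mu _).
  by apply/seteqP; split => t /=; rewrite !in_itv/= => /andP[h1 h2];
    apply/andP; split; lra.
rewrite !lebesgue_measure_itv/= !lte_fin ltrD2l ltrN2; case: ifP => // _.
by rewrite -!EFinD; congr EFin; ring.
Qed.

Lemma expi_reflection (t : R) : expi (2 * pi - t) = cconj (expi t).
Proof.
apply: val_inj => /=; congr Complex.
  by rewrite mulr_natl addrC cosD2pi cosN.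
by rewrite mulr_natl addrC sinD2pi sinN.
Qed.

Lemma cconjK : involutive (@cconj R).
Proof. by move=> w; apply: val_inj; rewrite /= conjcK. Qed.

(** On [0, 2 pi] conjugation becomes [t |-> 2 pi - t], which preserves
    Lebesgue measure. *)
Lemma ae_cconj (P : circle R -> Prop) :
  (\forall w \ae m, P w) -> \forall w \ae m, P (cconj w).
Proof.
move=> [N [mN N0 PN]]; exists (@cconj R @^-1` N).
have E : @expi R @^-1` (@cconj R @^-1` N) = (fun t => 2 * pi - t) @^-1` (@expi R @^-1` N).
  by apply/seteqP; split => t /=; rewrite expi_reflection.
have mE : measurable (@expi R @^-1` N : set (measurableTypeR R)).
  by rewrite -[_ @^-1` _]setTI; exact: measurable_expi.
have mr : measurable (@cconj R @^-1` N).
  rewrite /measurable/= /circle_measurable /image_set_system/= setTI E.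
  rewrite -[_ @^-1` _]setTI.
  have mr : measurable_fun setT ((fun t => 2 * pi - t) : measurableTypeR R -> measurableTypeR R).
    exact: measurable_funB.
  exact: mr.
split => //.
- apply/(circle_negligible mr).
  have /(circle_negligible mN) N0' := N0.
  rewrite E -N0' -[RHS](@lebesgue_measure_reflection (2 * pi)); last exact: measurableI.
  congr (mu _); rewrite preimage_setI; congr (_ `&` _).
  by apply/seteqP; split => t /=; rewrite !in_itv/= => /andP[h1 h2]; apply/andP; split; lra.
- by move=> w /= nP; apply: PN => /= Pw; exact: nP.
Qed.

End arc_length.

(** * Powers of the coordinate function *)

Section monomials.
Variable R : realType.
Local Notation C := R[i].
Local Notation m := (@circle_measure R).
Local Notation mu := (@lebesgue_measure R).
Local Notation I := `[0%R, 2 * pi : R]%classic.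
Local Notation Re := complex.Re.
Local Notation Im := complex.Im.

Definition zpow (k : int) (w : circle R) : C := val w ^ k.

Lemma circle_neq0 (w : circle R) : val w != 0.
Proof. by have := valP w; rewrite -normr_eq0 => /eqP ->; rewrite oner_eq0. Qed.

Lemma zpowD k l w : zpow (k + l) w = zpow k w * zpow l w.
Proof. by rewrite /zpow expfzDr// circle_neq0. Qed.

Lemma zpow0 w : zpow 0 w = 1. Proof. by rewrite /zpow expr0z. Qed.

Lemma conjc_circle (w : circle R) : conjc (val w) = (val w)^-1.
Proof.
have w0 := circle_neq0 w; apply: (mulfI w0); rewrite mulfV//.
by rewrite -sqr_normc (eqP (valP w)) expr1n.
Qed.

Lemma conjc_zpow k w : conjc (zpow k w) = zpow (- k) w.
Proof. by rewrite /zpow -exprz_inv -conjc_circle; exact: fmorphXz. Qed.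

Lemma expi_surj (w : circle R) : exists t, expi t = w.
Proof.
have [t E] : exists t, Complex (cos t) (sin t) = val w; last by exists t; exact: val_inj.
case: w => -[a b] /= /eqP; rewrite normc_def /= => /(congr1 (@complex.Re R)) /= h.
have ab : a ^+ 2 + b ^+ 2 = 1.
  rewrite -[LHS]sqr_sqrtr ?h ?expr1n//.
  by rewrite addr_ge0 ?sqr_ge0.
have a1 : -1 <= a <= 1.
  have := sqr_ge0 b; move: ab => /[swap]; nra.
have ain : a \in `[-1, 1] by rewrite in_itv.
have [b0|b0] := leP 0 b.
  exists (acos a); rewrite (acosK ain) sin_acos//.
  have -> : 1 - a ^+ 2 = b ^+ 2 by rewrite -ab; ring.
  by rewrite sqrtr_sqr ger0_norm.
exists (- acos a); rewrite cosN sinN (acosK ain) sin_acos//.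
have -> : 1 - a ^+ 2 = b ^+ 2 by rewrite -ab; ring.
by rewrite sqrtr_sqr ltr0_norm// opprK.
Qed.

Lemma zpow_expi (k : int) (t : R) :
  zpow k (expi t) = Complex (cos (k%:~R * t)) (sin (k%:~R * t)).
Proof.
have nat (n : nat) : zpow n (expi t) = Complex (cos (n%:R * t)) (sin (n%:R * t)).
  elim: n => [|n IH]; first by rewrite zpow0 mul0r cos0 sin0.
  rewrite (intS n) zpowD IH /zpow expr1z -add1n natrD mulrDl mul1r cosD sinD.
  by apply/eqP; rewrite eq_complex /=; apply/andP; split; apply/eqP; ring.
case: k => n; first exact: nat.
rewrite NegzE -conjc_zpow nat rmorphN/= mulNr cosN sinN.
by [].
Qed.

(** The sigma-algebra of the circle is the final one for [expi]. *)
Lemma measurable_circleP (f : circle R -> R) :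
  measurable_fun setT (fun t : measurableTypeR R => f (expi t)) ->
  measurable_fun setT f.
Proof.
move=> mf _ Y mY; rewrite setTI /measurable/= /circle_measurable.
rewrite /image_set_system/= setTI -comp_preimage.
by have := mf measurableT Y mY; rewrite setTI.
Qed.

Lemma continuous_cosM (a : R) : continuous (fun t : R => cos (a * t)).
Proof.
move=> t; apply: (@continuous_comp _ _ _ (fun t : R => a * t) cos).
  exact: mulrl_continuous.
exact: continuous_cos.
Qed.

Lemma continuous_sinM (a : R) : continuous (fun t : R => sin (a * t)).
Proof.
move=> t; apply: (@continuous_comp _ _ _ (fun t : R => a * t) sin).
  exact: mulrl_continuous.
exact: continuous_sin.
Qed.

Lemma zpow_cLp k : cLp +oo%E (zpow k).
Proof.
split; apply/LfunyP; split.
- apply: measurable_circleP; under eq_fun do rewrite zpow_expi.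
  by apply: continuous_measurable_fun; exact: continuous_cosM.
- exists 1; apply: nearW => w; have [t <-] := expi_surj w.
  by rewrite zpow_expi /= cos_max.
- apply: measurable_circleP; under eq_fun do rewrite zpow_expi.
  by apply: continuous_measurable_fun; exact: continuous_sinM.
- exists 1; apply: nearW => w; have [t <-] := expi_surj w.
  by rewrite zpow_expi /= sin_max.
Qed.

Lemma sin_int2pi (k : int) : sin (k%:~R * (2 * pi)) = 0 :> R.
Proof.
have nat (n : nat) : sin (n%:R * (2 * pi)) = 0 :> R.
  have := periodicn (@sinD2pi R) n 0.
  by rewrite add0r sin0 -(mulr_natl pi) -(mulr_natl (2 * pi)).
case: k => n; first exact: nat.
by rewrite NegzE rmorphN/= mulNr sinN nat oppr0.
Qed.

Lemma cos_int2pi (k : int) : cos (k%:~R * (2 * pi)) = 1 :> R.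
Proof.
have nat (n : nat) : cos (n%:R * (2 * pi)) = 1 :> R.
  have := periodicn (@cosD2pi R) n 0.
  by rewrite add0r cos0 -(mulr_natl pi) -(mulr_natl (2 * pi)).
case: k => n; first exact: nat.
by rewrite NegzE rmorphN/= mulNr cosN nat.
Qed.

(** For nonzero k the primitives [sin (k t) / k] and [- cos (k t) / k] are
    2 pi-periodic. *)
Lemma cintegral_zpow k : cintegral (zpow k) = (k == 0)%:R :> C.
Proof.
have [->|k0] := eqVneq k 0.
  rewrite /cintegral; under eq_Rintegral do rewrite zpow0.
  rewrite (_ : (\int[m]_w _)%R = 1); last first.
    by rewrite Rintegral_cst//= probability_setT mulr1.
  congr Complex; under eq_Rintegral do rewrite zpow0.
  by rewrite Rintegral_cst//= mul0r.
have kR : k%:~R != 0 :> R by rewrite intr_eq0.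
have [zr zi] := cLp_int (cLp21 (cLpy2 (zpow_cLp k))).
have pi2 : 0 < 2 * pi :> R by rewrite mulr_gt0// pi_gt0.
rewrite /cintegral !Rintegral_circle// (_ : false%:R = Complex 0 0)//.
have FTC (f F : R -> R) : continuous f ->
    (forall t : R, is_derive t (1 : R) F (f t)) -> F (2 * pi) = F 0 ->
    \int[mu]_(t in I) f t = 0.
  move=> cf dF F0; have cF : continuous F.
    by move=> t; apply: differentiable_continuous; apply/derivable1_diffP; have [] := dF t.
  rewrite /Rintegral (@continuous_FTC2 _ f F)//.
  - by rewrite F0 -EFinB subrr.
  - exact: continuous_subspaceT.
  - split.
    + by move=> t _; have [] := dF t.
    + exact: cvg_at_right_filter (cF _).
    + exact: cvg_at_left_filter (cF _).
  - by move=> t _; rewrite derive1E; have [_ ->] := dF t.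
have dM (a : R) (t : R) : is_derive t (1 : R) (fun t => a * t) a.
  have := @is_deriveZ R R R id a t 1 1 (is_derive_id t 1).
  by rewrite /GRing.scale /= mulr1.
have dS (f df : R -> R) (a : R) : (forall t : R, is_derive t (1 : R) f (df t)) ->
    a != 0 -> forall t : R, is_derive t (1 : R) (fun t => a^-1 * f (a * t)) (df (a * t)).
  move=> fdf a0 t.
  have := is_derive1_comp (fdf (a * t)) (dM a t).
  move=> /(@is_deriveZ R R R _ a^-1 t 1 _); rewrite /GRing.scale /=.
  by rewrite mulrCA mulVf// mulr1.
congr Complex.
  under eq_Rintegral do rewrite zpow_expi /=.
  rewrite (FTC _ (fun t => (k%:~R)^-1 * sin (k%:~R * t)) _ (dS _ _ _ (@is_derive_sin R) kR)) ?mulr0//.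
  - exact: continuous_cosM.
  - by rewrite ?(sin_int2pi, mulr0, sin0).
under eq_Rintegral do rewrite zpow_expi /=.
have dc t : is_derive t (1 : R) (fun t => - cos t) (sin t).
  by have := is_deriveN (is_derive_cos t); rewrite opprK.
rewrite (FTC _ (fun t => (k%:~R)^-1 * - cos (k%:~R * t)) _ (dS _ _ _ dc kR)) ?mulr0//.
- exact: continuous_sinM.
- by rewrite ?(cos_int2pi, mulr0, cos0).
Qed.

End monomials.

(** * Polynomials approximating a step *)

Section step.
Variable R : realType.

(** Polynomials in s that converge pointwise on [0, 1] to the indicator of
    [s <= 1 / 2].  The exponents are balanced so that
    [2 ^ (k ^ 2) * s ^ (k ^ 2 + k) = ((2 s) ^ k s) ^ k] tends to 0 for
    [s <= 1 / 2], the threshold included, and to infinity for [s > 1 / 2]. *)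
Definition step (s : R) (k : nat) : R := (1 - s ^+ (k ^ 2 + k)) ^+ (2 ^ (k ^ 2)).

Lemma bernoulli_ge (y : R) n : -1 <= y -> 1 + n%:R * y <= (1 + y) ^+ n.
Proof.
move=> y1; elim: n => [|n IH]; first by rewrite mul0r addr0 expr0.
rewrite exprS; have y1' : 0 <= 1 + y by lra.
apply: le_trans (ler_wpM2l y1' IH).
rewrite -natr1; have := mulr_ge0 (ler0n R n) (sqr_ge0 y).
move: (n%:R) => z; rewrite expr2; nra.
Qed.

Lemma step_itv (s : R) k : 0 <= s <= 1 -> 0 <= step s k <= 1.
Proof.
move=> /andP[s0 s1]; have y0 := exprn_ge0 (k ^ 2 + k) s0.
have y1 := exprn_ile1 (k ^ 2 + k) s0 s1.
by rewrite /step exprn_ge0 ?exprn_ile1//; lra.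
Qed.

(** Both cases follow from Bernoulli's inequality: [1 - N y <= (1 - y) ^ N]
    below the threshold, and [(1 - y) ^ N (1 + N y) <= (1 - y^2) ^ N <= 1] above
    it. *)
Lemma step_cvg (s : R) : 0 <= s <= 1 ->
  step s @ \oo --> ((s <= 2^-1)%R%:R : R).
Proof.
move=> s01; have /andP[s0 s1] := s01.
have half0 : (fun k => (2^-1 : R) ^+ k) @ \oo --> (0 : R).
  by apply: cvg_expr; rewrite ger0_norm ?invr_ge0//; lra.
have [sh|sh] := leP s 2^-1.
  apply: (@squeeze_cvgr _ _ _ _ (fun k => 1 - (2^-1 : R) ^+ k) (fun=> 1)).
  - apply: nearW => k; rewrite (andP (step_itv k s01)).2 andbT /step.
    have y0 := exprn_ge0 (k ^ 2 + k) s0.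
    have y1 := exprn_ile1 (k ^ 2 + k) s0 s1.
    set y := s ^+ _ in y0 y1 *.
    apply: le_trans (_ : 1 + (2 ^ (k ^ 2))%:R * (- y) <= _); last first.
      by apply: bernoulli_ge; lra.
    rewrite mulrN lerD2l lerN2.
    have -> : (2^-1 : R) ^+ k = (2 ^ (k ^ 2))%:R * (2^-1) ^+ (k ^ 2 + k).
      by rewrite exprD mulrA natrX -exprMn mulfV ?pnatr_eq0// expr1n mul1r.
    by rewrite ler_wpM2l// /y lerXn2r ?nnegrE ?invr_ge0.
  - by rewrite -[X in _ --> X]subr0; apply: cvgB => //; exact: cvg_cst.
  - exact: cvg_cst.
apply: (@squeeze_cvgr _ _ _ _ (fun=> 0) (fun k => (2^-1 : R) ^+ k)) => //; last exact: cvg_cst.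
have sp : 0 < s by apply: lt_trans sh; rewrite invr_gt0.
have q1 : `|(2 * s)^-1| < 1.
  rewrite ger0_norm ?invr_ge0 ?mulr_ge0//.
  by rewrite invf_lt1 ?mulr_gt0//; move: sh; rewrite -(ltr_pM2l (ltr0n R 2)) mulfV ?pnatr_eq0.
have := cvg_expr q1 => /cvgrPdist_lt/(_ (s / 2)).
rewrite divr_gt0// => /(_ isT); apply: filterS => k.
have -> : `|0 - (2 * s)^-1 ^+ k| = (2 * s)^-1 ^+ k.
  by rewrite sub0r normrN ger0_norm// exprn_ge0// invr_ge0 mulr_ge0.
move=> hk.
have /andP[st0 st1] := step_itv k s01; rewrite st0 /=.
have y0 := exprn_ge0 (k ^ 2 + k) s0.
have y1 := exprn_ile1 (k ^ 2 + k) s0 s1.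
set N := (2 ^ (k ^ 2))%N.
(* The hypothesis on k says that [(2 s) ^ k s >= 2]. *)
have big : 2 ^+ k <= N%:R * s ^+ (k ^ 2 + k).
  rewrite /N natrX exprD mulrA -exprMn -mulnn exprM -exprMn.
  rewrite lerXn2r ?nnegrE ?mulr_ge0 ?exprn_ge0// ?mulr_ge0//.
  have p0 : 0 < (2 * s) ^+ k by rewrite exprn_gt0// mulr_gt0.
  move: hk; rewrite exprVn -(ltr_pM2l p0) mulfV ?gt_eqF//.
  by rewrite mulrA ltr_pdivlMr// mul1r => /ltW.
rewrite /step -/N; set y := s ^+ _ in y0 y1 big *.
have le1 : (1 - y) ^+ N * (1 + N%:R * y) <= 1.
  have h0 : 0 <= (1 - y) ^+ N by apply: exprn_ge0; lra.
  apply: le_trans (ler_wpM2l h0 (bernoulli_ge N _)) _; first lra.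
  by rewrite -exprMn exprn_ile1//; nra.
have h0 : 0 <= (1 - y) ^+ N by apply: exprn_ge0; lra.
have := ler_wpM2l h0 big; rewrite exprVn -ler_pdivlMr ?exprn_gt0// => h.
by apply: le_trans h _; rewrite ler_pdivrMr ?exprn_gt0// mulVf ?expf_neq0//; lra.
Qed.

End step.

(** * Functions with vanishing interval integrals *)

Section differentiation.
Variable R : realType.
Local Notation mu := (@lebesgue_measure R).

(** At a Lebesgue point x the value of f is the limit of its means over
    the balls around x, and these vanish.  Almost every point is a Lebesgue
    point. *)
Lemma ae_eq0_of_integral_itv (a b : R) (f : R -> R) :
  mu.-integrable `[a, b] (EFin \o f) ->
  (forall x r, 0 < r -> a < x - r -> x + r < b ->
     \int[mu]_(t in `[x - r, x + r]) f t = 0) ->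
  mu.-negligible [set t | t \in `[a, b] /\ f t != 0].
Proof.
move=> intf H.
pose g := f \_ `[a, b].
have intg : mu.-integrable setT (EFin \o g).
  have mab : measurable (`[a, b]%classic : set (measurableTypeR R)) by [].
  rewrite (_ : EFin \o g = (EFin \o f) \_ `[a, b]); last by rewrite restrict_EFin.
  exact/(integrable_mkcond _ mab).
have [N [mN N0 NP]] := lebesgue_differentiation (open_integrable_locally openT intg).
apply: (@negligibleS _ _ _ mu (N `|` ([set a] `|` [set b]))); last first.
  apply: negligibleU; first by apply/negligibleP.
  by apply: negligibleU; apply/negligibleP => //; exact: lebesgue_measure_set1.
move=> x /= [xab fx].
have [->|xa] := eqVneq x a; first by right; left.
have [->|xb] := eqVneq x b; first by right; right.
left; apply: NP => /= Lx; move/eqP: fx; apply.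
move: xab; rewrite in_itv /= => /andP[ax bx].
have {}ax : a < x by rewrite lt_def xa.
have {}bx : x < b by rewrite lt_def eq_sym xb.
have gx : g x = f x by rewrite /g patchE mem_set//= in_itv/= !ltW.
rewrite -gx; apply/eqP; rewrite -normr_le0 -lee_fin.
apply: (cvge_ge _ Lx).
near=> r.
have r0 : 0 < r by near: r; exact: nbhs_right_gt.
have ra : r < x - a by near: r; apply: nbhs_right_lt; rewrite subr_gt0.
have rb : r < b - x by near: r; apply: nbhs_right_lt; rewrite subr_gt0.
have mB : measurable (ball x r : set R) by exact: measurable_ball.
have intB : mu.-integrable (ball x r) (EFin \o g).
  exact: integrableS intg.
have muB : mu (ball x r) = (r *+ 2)%:E by rewrite lebesgue_measure_ball// ltW.
have intgx : mu.-integrable (ball x r) (EFin \o cst (g x)).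
  apply/integrableP; split; first exact/measurable_EFinP/measurable_cst.
  rewrite (_ : (fun _ => _) = cst `|g x|%:E)//.
  rewrite integral_cst//= muB -EFinM; exact: ltry.
have int0 : (\int[mu]_(y in ball x r) (g y)%:E = 0)%E.
  have mf' : measurable_fun `]x - r, x + r[ (EFin \o g).
    by apply: measurable_funTS; case/integrableP: intg.
  rewrite ball_itv -(integral_itv_bndoo true false mf').
  transitivity (\int[mu]_(y in `[(x - r)%R, (x + r)%R]) (f y)%:E)%E.
    apply: eq_integral => y; rewrite inE/= in_itv/= => /andP[y1 y2].
    by rewrite /g patchE mem_set//= in_itv/=; apply/andP; split; lra.
  have h1 : a < x - r by lra.
  have h2 : x + r < b by lra.
  have := congr1 EFin (H x r r0 h1 h2).
  rewrite /Rintegral fineK//; apply: integrable_fin_num => //.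
  apply: integrableS intf => //.
  by move=> y /=; rewrite !in_itv/= => /andP[y1 y2]; apply/andP; split; lra.
rewrite /davg /iavg muB inver mulrn_eq0/= gt_eqF//=.
rewrite lee_pdivlMl ?mulrn_wgt0//.
have -> : ((r *+ 2)%:E * `|g x|%:E = `|\int[mu]_(y in ball x r) ((g y)%:E - (g x)%:E)|)%E.
  rewrite integralB_EFin// int0 integral_cst//= muB sub0e abseN.
  by rewrite abseM muleC/= (ger0_norm (_ : 0 <= r *+ 2)) ?mulrn_wge0 ?ltW.
apply: le_abse_integral => //.
apply: measurable_funTS; apply: emeasurable_funB => //; first by case/integrableP: intg.
Unshelve. all: end_near. Qed.

End differentiation.

(** * Uniqueness of Fourier coefficients *)

Section uniqueness.
Variable R : realType.
Local Notation C := R[i].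
Local Notation m := (@circle_measure R).
Local Notation mu := (@lebesgue_measure R).
Local Notation I := `[0%R, 2 * pi : R]%classic.
Local Notation Re := complex.Re.
Local Notation Im := complex.Im.

Section annihilator.
Variable phi : circle R -> C.
Hypothesis phi2 : cLp 2%:E phi.

(** The bounded multipliers g for which phi g has vanishing Fourier
    coefficients.  They are stable under multiplication by powers of the
    coordinate, hence by trigonometric polynomials. *)
Definition annihilated (g : circle R -> C) : Prop :=
  cLp +oo%E g /\ forall k, cintegral (fun w => phi w * (g w * zpow k w)) = 0.

Lemma cLp1_mul g : cLp +oo%E g -> cLp 1 (fun w => phi w * g w).
Proof. by move=> gy; apply: cLp2M => //; exact: cLpy2. Qed.

Lemma annihilatedZ c g : annihilated g -> annihilated (fun w => c * g w).
Proof.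
move=> [gy g0]; split=> [|k]; first exact: cLpZ.
rewrite -[RHS](mulr0 c) -(g0 k) -cintegralZ.
  by congr cintegral; apply/funext => w; ring.
by apply: (@cLp1_mul (fun w => g w * zpow k w)); apply: cLpyMy => //; exact: zpow_cLp.
Qed.

Lemma annihilatedD f g : annihilated f -> annihilated g ->
  annihilated (fun w => f w + g w).
Proof.
move=> [fy f0] [gy g0]; split=> [|k]; first exact: cLpD.
have h u : cLp +oo%E u -> cLp 1 (fun w => phi w * (u w * zpow k w)).
  move=> uy; apply: (@cLp1_mul (fun w => u w * zpow k w)).
  by apply: cLpyMy => //; exact: zpow_cLp.
transitivity (cintegral (fun w => phi w * (f w * zpow k w)) +
  cintegral (fun w => phi w * (g w * zpow k w))); last by rewrite f0 g0 addr0.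
rewrite -cintegralD; [|exact: h|exact: h].
by congr cintegral; apply/funext => w; ring.
Qed.

Lemma annihilated_zpow j g : annihilated g ->
  annihilated (fun w => zpow j w * g w).
Proof.
move=> [gy g0]; split=> [|k]; first by apply: cLpyMy => //; exact: zpow_cLp.
by rewrite -(g0 (j + k)); congr cintegral; apply/funext => w; rewrite zpowD; ring.
Qed.

(** The trigonometric polynomial [(2 + c - Re (conjc a * w)) / 4].  For
    [-1 <= c <= 1] it takes its values in [0, 1], and it is at most 1 / 2
    exactly on the arc around a where [Re (conjc a * w) >= c]. *)
Definition arcC (c : R) (a w : circle R) : C :=
  ((2 + c) / 4)%:C%C - 8^-1 * (conjc (val a) * zpow 1 w + val a * zpow (-1) w).

Lemma annihilated_arc c a g : annihilated g ->
  annihilated (fun w => arcC c a w * g w).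
Proof.
move=> ag.
have h1 := annihilatedZ (- 8^-1 * conjc (val a)) (annihilated_zpow 1 ag).
have h2 := annihilatedZ (- 8^-1 * val a) (annihilated_zpow (-1) ag).
have := annihilatedD (annihilatedZ ((2 + c) / 4)%:C%C ag) (annihilatedD h1 h2).
by congr annihilated; apply/funext => w; rewrite /arcC; ring.
Qed.

Lemma annihilated_arcX c a p g : annihilated g ->
  annihilated (fun w => arcC c a w ^+ p * g w).
Proof.
move=> ag; elim: p => [|p IH]; first by under eq_fun do rewrite expr0 mul1r.
by under eq_fun do rewrite exprS -mulrA; exact: annihilated_arc.
Qed.

Lemma annihilated_arc_step c a p q g : annihilated g ->
  annihilated (fun w => (1 - arcC c a w ^+ p) ^+ q * g w).
Proof.
move=> ag; elim: q => [|q IH]; first by under eq_fun do rewrite expr0 mul1r.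
have := annihilatedD IH (annihilatedZ (-1) (annihilated_arcX c a p IH)).
by congr annihilated; apply/funext => w; rewrite exprS; ring.
Qed.

End annihilator.

Definition arc (c x t : R) : R := (2 + c - cos (t - x)) / 4.

Lemma arcC_expi c x t : arcC c (expi x) (expi t) = (arc c x t)%:C%C.
Proof.
rewrite /arcC !zpow_expi /arc /= mulN1r mul1r cosN sinN cosB.
have -> : (8^-1 : C) = (8^-1)%:C%C by rewrite fmorphV rmorph_nat.
by apply/eqP; rewrite eq_complex /=; apply/andP; split; apply/eqP; field.
Qed.

Lemma arc_itv c x t : -1 <= c <= 1 -> 0 <= arc c x t <= 1.
Proof.
move=> /andP[c0 c1]; have := cos_geN1 (t - x); have := cos_le1 (t - x).
rewrite /arc; move: (cos _) => y *; apply/andP; split; lra.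
Qed.

(** The bounds on x and r keep the arc of radius r around x inside ]0, 2 pi[,
    so that on [0, 2 pi] it is an interval: the points with
    [|t - x| > pi] lie within distance r of x on the circle only if the arc
    passes through the point 1. *)
Lemma cos_ge_arc (x r t : R) : 0 < r -> 0 < x - r -> x + r < 2 * pi -> t \in `[0, 2 * pi] ->
  (cos r <= cos (t - x)) = (t \in `[x - r, x + r]).
Proof.
move=> r0 xr0 xr1; rewrite !in_itv/= => /andP[t0 t1].
have pi0 := @pi_gt0 R.
rewrite -(cos_norm (t - x)); set d := `|t - x|.
have -> : (x - r <= t <= x + r) = (d <= r) by rewrite ler_distl addrC.
have dlt : d < 2 * pi.
  by rewrite /d ltr_norml; apply/andP; split; lra.
have rpi : r < pi by lra.
have rI : r \in `[0, pi] by rewrite in_itv/=; lra.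
have d0 : 0 <= d by exact: normr_ge0.
have [dpi|dpi] := leP d pi.
  have dI : d \in `[0, pi] by rewrite in_itv/= d0.
  by rewrite !leNgt (ltr_cos rI dI).
have d'I : 2 * pi - d \in `[0, pi] by rewrite in_itv/=; apply/andP; split; lra.
have -> : cos d = cos (2 * pi - d).
  by rewrite addrC mulr_natl cosD2pi cosN.
rewrite [RHS]leNgt (lt_trans rpi dpi) /= leNgt (ltr_cos rI d'I).
apply/negbTE; rewrite negbK.
by rewrite /d; case: (ger0P (t - x)) => _; lra.
Qed.

Lemma arc_le_half x r t : 0 < r -> 0 < x - r -> x + r < 2 * pi -> t \in `[0, 2 * pi] ->
  (arc (cos r) x t <= 2^-1) = (t \in `[x - r, x + r]).
Proof.
move=> r0 xr0 xr1 tI; rewrite -cos_ge_arc// /arc; apply/idP/idP; lra.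
Qed.

Definition arc_stepC c a k w : C :=
  (1 - arcC c a w ^+ (k ^ 2 + k)) ^+ (2 ^ (k ^ 2)).

Lemma arc_stepC_expi c x t k :
  arc_stepC c (expi x) k (expi t) = (step (arc c x t) k)%:C%C.
Proof.
by rewrite /arc_stepC arcC_expi /step !(rmorphXn, rmorphB, rmorph1).
Qed.

(** The approximating polynomials take their values in [0, 1], so dominated
    convergence passes to the indicator of the arc. *)
Lemma arc_integral_limit (u : circle R -> R) x r :
  m.-integrable setT (EFin \o u) ->
  (forall k, m.-integrable setT
     (EFin \o (fun w => u w * Re (arc_stepC (cos r) (expi x) k w)))) ->
  (forall k, \int[m]_w (u w * Re (arc_stepC (cos r) (expi x) k w)) = 0) ->
  0 < r -> 0 < x - r -> x + r < 2 * pi ->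
  \int[mu]_(t in `[x - r, x + r]) u (expi t) = 0.
Proof.
move=> intu intk int0 r0 xr0 xr1.
pose J := `[x - r, x + r]%classic.
pose psi t := u (expi t).
pose F k t := psi t * step (arc (cos r) x t) k.
have pi2 : 0 < 2 * pi :> R by rewrite mulr_gt0// pi_gt0.
have mJ : measurable (J : set (measurableTypeR R)) by exact: measurable_itv.
have mpsi : measurable_fun setT (psi : measurableTypeR R -> R).
  by apply: measurable_circle_expi; case/integrableP : intu => /measurable_EFinP.
have JI : J `<=` I.
  by move=> t; rewrite /J /= !in_itv/= => /andP[t1 t2]; apply/andP; split; lra.
have intpsi : mu.-integrable I (EFin \o psi) := integrable_circle intu.
have FE k : F k = (fun t => u (expi t) * Re (arc_stepC (cos r) (expi x) k (expi t))).
  by apply/funext => t; rewrite arc_stepC_expi.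
have intF k : mu.-integrable I (EFin \o F k).
  by rewrite FE; exact: (integrable_circle (intk k)).
have intF0 k : (\int[mu]_(t in I) (F k t)%:E = 0)%E.
  have := int0 k; rewrite Rintegral_circle// => /eqP.
  have c0 : (2 * pi)^-1 != 0 :> R by rewrite invr_eq0 gt_eqF.
  rewrite mulf_eq0 (negbTE c0) /= => /eqP E; have := congr1 EFin E.
  rewrite /Rintegral fineK ?FE//.
  by have := integrable_fin_num _ (intF k); rewrite FE; exact.
have c1 : -1 <= cos r <= 1 by rewrite cos_geN1 cos_le1.
pose G t := psi t * \1_J t.
have lim : [/\ mu.-integrable I (EFin \o G),
    [sequence \int[mu]_(t in I) `|(F k t)%:E - (G t)%:E| ]_k @ \oo --> 0%E &
    [sequence \int[mu]_(t in I) (F k t)%:E]_k @ \oo -->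
      (\int[mu]_(t in I) (G t)%:E)%E]%E.
  apply: (@dominated_convergence _ _ _ mu I _ (fun k => EFin \o F k)
    (EFin \o G) (fun t => `|psi t|%:E)) => //.
  - by move=> k; case/integrableP : (intF k).
  - apply/measurable_EFinP; apply: measurable_funTS.
    by apply: measurable_funM.
  - apply: nearW => t tI; apply: cvg_EFin; first exact: nearW.
    apply: cvgM; first exact: cvg_cst.
    have := step_cvg (arc_itv x t c1).
    rewrite arc_le_half//; suff -> : \1_J t = (t \in `[x - r, x + r])%:R :> R by exact.
    by rewrite indicE mem_setE.
  - exact: (integrable_abse intpsi).
  - apply: nearW => t k _; rewrite /= lee_fin normrM ler_piMr//.
    by have /andP[s0 s1] := step_itv k (arc_itv x t c1); rewrite ger0_norm.
case: lim => intlim _ lim.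
have E0 : (\int[mu]_(t in I) (G t)%:E = 0)%E.
  apply: (cvg_unique _ lim) => //.
  rewrite (_ : (fun k => _) = cst 0%E); first exact: cvg_cst.
  by apply/funext => k; exact: intF0.
transitivity (\int[mu]_(t in I `&` J) psi t); first by rewrite setIidr.
rewrite Rintegral_mkcondr /Rintegral.
suff -> : (\int[mu]_(t in I) ((psi \_ J) t)%:E = 0)%E by [].
rewrite -[RHS]E0; apply: eq_integral => t _.
by rewrite patchE /G indicE; case: ifP => _; rewrite ?mulr1 ?mulr0.
Qed.

Lemma real_unique (u : circle R -> R) :
  m.-integrable setT (EFin \o u) ->
  (forall c a k, m.-integrable setT
     (EFin \o (fun w => u w * Re (arc_stepC c a k w)))) ->
  (forall c a k, \int[m]_w (u w * Re (arc_stepC c a k w)) = 0) ->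
  \forall w \ae m, u w = 0.
Proof.
move=> intu intk int0.
have mu_ : measurable_fun setT u by case/integrableP : intu => /measurable_EFinP.
pose A := [set w | u w != 0].
have mA : measurable A.
  rewrite (_ : A = ~` (u @^-1` [set 0])); last first.
    by apply/seteqP; split => w /=; [move/eqP | move=> ?; exact/eqP].
  apply: measurableC; rewrite -[_ @^-1` _]setTI; exact: mu_.
have A0 : m A = 0%E.
  apply/(circle_negligible mA).
  have mE : measurable (@expi R @^-1` A : set (measurableTypeR R)).
    by rewrite -[_ @^-1` _]setTI; exact: measurable_expi.
  have [|N [mN N0 NP]] := @ae_eq0_of_integral_itv R 0 (2 * pi) (fun t => u (expi t)) (integrable_circle intu).
    by move=> x r r0 h1 h2; apply: arc_integral_limit.
  apply/negligibleP; first exact: measurableI.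
  exists N; split => // t [At It]; apply: NP; split => //.
by exists A; split => // w /= /eqP.
Qed.

(** The function phi integrates to 0 against trigonometric polynomials, hence
    over all small arcs by [arc_integral_limit]; differentiating along arcs that
    shrink to a point shows that it vanishes almost everywhere. *)
Lemma fourier_unique (phi : circle R -> C) : cLp 2%:E phi ->
  (forall k, cintegral (fun w => phi w * zpow k w) = 0) ->
  \forall w \ae m, phi w = 0.
Proof.
move=> phi2 phi0.
have one : annihilated phi (fun=> 1).
  split=> [|k]; first exact: cLp_cst.
  by under eq_fun do rewrite mul1r; exact: phi0.
have st c a k : cLp 1 (fun w => phi w * arc_stepC c a k w) /\
    cintegral (fun w => phi w * arc_stepC c a k w) = 0.
  have [hy h0] := annihilated_arc_step phi2 c a (k ^ 2 + k) (2 ^ (k ^ 2)) one.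
  have E : (fun w => (1 - arcC c a w ^+ (k ^ 2 + k)) ^+ (2 ^ (k ^ 2)) * 1) = arc_stepC c a k.
    by apply/funext => w; rewrite mulr1.
  rewrite E in hy; split; first exact: cLp1_mul.
  by rewrite -(h0 0); congr cintegral; apply/funext => w; rewrite zpow0 !mulr1.
have stR c a k w : Im (arc_stepC c a k w) = 0.
  have [x <-] := expi_surj a; have [t <-] := expi_surj w.
  by rewrite arc_stepC_expi.
have [intr inti] := cLp_int (cLp21 phi2).
have aeR : \forall w \ae m, Re (phi w) = 0.
  apply: real_unique => // c a k; have [h1 h0] := st c a k.
    have [h _] := cLp_int h1; move: h; congr (integrable _ _ _).
    by apply/funext => w /=; rewrite complex_ReM stR mulr0 subr0.
  have := congr1 (@complex.Re R) h0; rewrite /cintegral /= => <-.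
  by apply: eq_Rintegral => w _; rewrite complex_ReM stR mulr0 subr0.
have aeI : \forall w \ae m, Im (phi w) = 0.
  apply: real_unique => // c a k; have [h1 h0] := st c a k.
    have [_ h] := cLp_int h1; move: h; congr (integrable _ _ _).
    by apply/funext => w /=; rewrite complex_ImM stR mulr0 add0r.
  have := congr1 (@complex.Im R) h0; rewrite /cintegral /= => <-.
  by apply: eq_Rintegral => w _; rewrite complex_ImM stR mulr0 add0r.
apply: filterS2 aeR aeI => w; case: (phi w) => a b /= -> ->; by [].
Qed.

End uniqueness.

(** * The vector-valued Hardy space *)

Section fourier_coefficients.
Variable R : realType.
Local Notation C := R[i].
Local Notation m := (@circle_measure R).
Implicit Types f g : circle R -> C.

Lemma fourierE f k : fourier f k = cintegral (fun w => f w * zpow (- k) w).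
Proof. by []. Qed.

Lemma cLp_fourier f k : cLp 2%:E f -> cLp 1 (fun w => f w * zpow k w).
Proof. by move=> f2; apply: cLp2M => //; apply/cLpy2/zpow_cLp. Qed.

Lemma fourierD f g k : cLp 2%:E f -> cLp 2%:E g ->
  fourier (fun w => f w + g w) k = fourier f k + fourier g k.
Proof.
move=> f2 g2; rewrite /fourier -cintegralD; [|exact: cLp_fourier|exact: cLp_fourier].
by congr cintegral; apply/funext => w; rewrite mulrDl.
Qed.

Lemma fourierZ c f k : cLp 2%:E f ->
  fourier (fun w => c * f w) k = c * fourier f k.
Proof.
move=> f2; rewrite /fourier -cintegralZ; last exact: cLp_fourier.
by congr cintegral; apply/funext => w; rewrite mulrA.
Qed.

Lemma fourier_sum I (s : seq I) (F : I -> circle R -> C) k :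
  (forall i, cLp 2%:E (F i)) ->
  fourier (fun w => \sum_(i <- s) F i w) k = \sum_(i <- s) fourier (F i) k.
Proof.
move=> F2; rewrite /fourier -(@cintegral_sum _ _ _ (fun i w => F i w * val w ^ (- k))).
  by congr cintegral; apply/funext => w; rewrite mulr_suml.
by move=> i; exact: cLp_fourier.
Qed.

Lemma fourier_zpowM f l k : fourier (fun w => f w * zpow l w) k = fourier f (k - l).
Proof.
rewrite !fourierE; congr cintegral; apply/funext => w.
by rewrite -mulrA -zpowD opprB addrC.
Qed.

Lemma fourier_cst (c : C) k : fourier (fun=> c) k = c * (k == 0)%:R.
Proof.
rewrite fourierE cintegralZ; last exact/cLp21/cLpy2/zpow_cLp.
by rewrite cintegral_zpow oppr_eq0.
Qed.

End fourier_coefficients.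

Section hardy.
Variables (R : realType) (n : nat).
Local Notation C := R[i].
Local Notation m := (@circle_measure R).
Local Notation V := (circle R -> 'cV[C]_n).
Local Notation M := (circle R -> 'M[C]_n).
Local Notation L2 := (@L2E R n).
Local Notation ip := (@innerE R n).
Local Notation SI := (@semi_innerE R n).
Implicit Types (f g h u : V) (F G : M) (A : 'M[C]_n) (c : 'cV[C]_n).

Definition fourierV f k : 'cV[C]_n := \col_i fourier (fun w => f w i 0) k.
Definition fourierM F k : 'M[C]_n := \matrix_(i, j) fourier (fun w => F w i j) k.

Definition zvec (k : int) (j : 'I_n) : V := fun w => zpow k w *: delta_mx j 0.

Lemma LinfMP F : LinfM F <-> forall i j, cLp +oo%E (fun w => F w i j).
Proof. by split=> FL i j; apply/LpyE. Qed.

Lemma LinfM_mul F G : LinfM F -> LinfM G -> LinfM (fun w => F w *m G w).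
Proof.
move=> /LinfMP FL /LinfMP GL; apply/LinfMP => i j.
under eq_fun do rewrite mxE.
by apply: cLp_sum => // k; exact: cLpyMy.
Qed.

Lemma LinfM_cst A : LinfM (fun=> A).
Proof. by apply/LinfMP => i j; exact: cLp_cst. Qed.

Lemma L2E_mul F f : LinfM F -> L2 f -> L2 (fun w => F w *m f w).
Proof.
move=> /LinfMP FL /L2EP f2; apply/L2EP => i.
under eq_fun do rewrite mxE.
by apply: cLp_sum => // k; exact: (cLpyM2 (FL i k) (f2 k)).
Qed.

Lemma L2E_zpow k f : L2 f -> L2 (fun w => zpow k w *: f w).
Proof.
move=> /L2EP f2; apply/L2EP => i.
under eq_fun do rewrite mxE.
exact: (cLpyM2 (zpow_cLp R k) (f2 i)).
Qed.

Lemma L2E_cst c : L2 (fun=> c).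
Proof. by apply/L2EP => i; exact: cLp_cst. Qed.

Lemma L2E_zvec k j : L2 (zvec k j).
Proof. by apply: (@L2E_zpow k (fun=> delta_mx j 0)); exact: L2E_cst. Qed.

Lemma fourierVD f g k : L2 f -> L2 g ->
  fourierV (f + g) k = fourierV f k + fourierV g k.
Proof.
move=> /L2EP f2 /L2EP g2; apply/colP => i; rewrite !mxE -fourierD//.
by congr fourier; apply/funext => w; rewrite !mxE.
Qed.

Lemma fourierVZ a f k : L2 f -> fourierV (a *: f) k = a *: fourierV f k.
Proof.
move=> /L2EP f2; apply/colP => i; rewrite !mxE -fourierZ//.
by congr fourier; apply/funext => w; rewrite !mxE.
Qed.

Lemma fourierVB f g k : L2 f -> L2 g ->
  fourierV (f - g) k = fourierV f k - fourierV g k.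
Proof.
move=> f2 g2; rewrite -scaleN1r fourierVD//; last exact: (siZ SI).
by rewrite fourierVZ// scaleN1r.
Qed.

Lemma fourierV_mulmx A f k : L2 f ->
  fourierV (fun w => A *m f w) k = A *m fourierV f k.
Proof.
move=> /L2EP f2; apply/colP => i; rewrite !mxE.
under [X in fourier X]eq_fun do rewrite mxE.
rewrite fourier_sum => [|j]; last exact: cLpZ.
by apply: eq_bigr => j _; rewrite mxE -fourierZ.
Qed.

Lemma fourierV_zpow l f k :
  fourierV (fun w => zpow l w *: f w) k = fourierV f (k - l).
Proof.
apply/colP => i; rewrite !mxE -fourier_zpowM; congr fourier.
by apply/funext => w; rewrite mxE mulrC.
Qed.

Lemma fourierV_cst c k : fourierV (fun=> c) k = (k == 0)%:R *: c.
Proof. by apply/colP => i; rewrite !mxE fourier_cst mulrC. Qed.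

Lemma fourierV_mul_cst F c k : LinfM F ->
  fourierV (fun w => F w *m c) k = fourierM F k *m c.
Proof.
move=> /LinfMP FL; apply/colP => i; rewrite !mxE.
under [X in fourier X]eq_fun do rewrite mxE.
rewrite (_ : (fun _ => _) = (fun w => \sum_j c j 0 * F w i j)); last first.
  by apply/funext => w; apply: eq_bigr => j _; rewrite mulrC.
rewrite fourier_sum => [|j]; last by apply: cLpZ => //; exact: cLpy2.
by apply: eq_bigr => j _; rewrite mxE mulrC fourierZ//; exact: cLpy2.
Qed.

Lemma fourierM_mulr F A k : LinfM F ->
  fourierM (fun w => F w *m A) k = fourierM F k *m A.
Proof.
move=> FL; apply/matrixP => i j.
transitivity (fourierV (fun w => F w *m col j A) k i 0).
  rewrite !mxE; congr fourier; apply/funext => w; rewrite !mxE.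
  by apply: eq_bigr => l _; rewrite mxE.
rewrite fourierV_mul_cst// !mxE; apply: eq_bigr => l _; by rewrite !mxE.
Qed.

Lemma fourierM_mull F A k : LinfM F ->
  fourierM (fun w => A *m F w) k = A *m fourierM F k.
Proof.
move=> /LinfMP FL; apply/matrixP => i j; rewrite !mxE.
under [X in fourier X]eq_fun do rewrite mxE.
rewrite fourier_sum => [|l]; last by apply: cLpZ => //; exact: cLpy2.
by apply: eq_bigr => l _; rewrite mxE fourierZ//; exact: cLpy2.
Qed.

Lemma HinfMP F : LinfM F -> (HinfM F <-> forall k, k < 0 -> fourierM F k = 0).
Proof.
move=> FL; split=> [FH k k0|F0 i j].
  by apply/matrixP => i j; rewrite !mxE; exact: (FH i j).2.
split=> [|k k0]; first exact: FL.
by have /matrixP/(_ i j) := F0 k k0; rewrite !mxE.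
Qed.

Lemma HinfM_LinfM F : HinfM F -> LinfM F.
Proof. by move=> FH i j; have [] := FH i j. Qed.

Lemma H2EP f : H2E f <-> L2 f /\ forall k, k < 0 -> fourierV f k = 0.
Proof.
split=> -[f2 f0]; split=> //.
  by move=> k k0; apply/colP => i; rewrite !mxE; exact: f0.
move=> i k k0; by have /colP/(_ i) := f0 k k0; rewrite !mxE.
Qed.

Lemma fourierV_inner f k i : L2 f -> fourierV f k i 0 = ip f (zvec k i).
Proof.
move=> f2; rewrite innerEE//; last exact: L2E_zvec.
rewrite mxE (bigD1 i)//= big1 => [|j ji]; rewrite ?addr0.
  rewrite fourierE; congr cintegral; apply/funext => w.
  by rewrite !mxE !eqxx mulr1 conjc_zpow.
rewrite -[RHS](@cintegral0 R); congr cintegral; apply/funext => w.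
by rewrite !mxE (negbTE ji) mulr0 conjc0 mulr0.
Qed.

Lemma H2E0 : H2E (0 : V).
Proof.
apply/H2EP; split=> [|k _]; first exact: (si0 SI).
by have := fourierVB k (si0 SI) (si0 SI); rewrite !subrr.
Qed.

Lemma H2E_L2 f : H2E f -> L2 f. Proof. by case. Qed.

Lemma H2E_lin a f g : H2E f -> H2E g -> H2E (a *: f + g).
Proof.
move=> /H2EP[f2 f0] /H2EP[g2 g0]; apply/H2EP; split; first exact: (si_lin SI).
move=> k k0; rewrite fourierVD//; last exact: (siZ SI).
by rewrite fourierVZ// f0// g0// scaler0 addr0.
Qed.

Lemma H2E_D f g : H2E f -> H2E g -> H2E (f + g).
Proof. by move=> fH gH; rewrite -(scale1r f); exact: H2E_lin. Qed.

Lemma H2E_B f g : H2E f -> H2E g -> H2E (f - g).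
Proof. by move=> fH gH; rewrite addrC -scaleN1r; exact: H2E_lin. Qed.

Lemma H2E_cst c : H2E (fun=> c).
Proof.
apply/H2EP; split=> [|k k0]; first exact: L2E_cst.
by rewrite fourierV_cst (lt_eqF k0) scale0r.
Qed.

Lemma H2E_zpow (l : nat) f : H2E f -> H2E (fun w => zpow l w *: f w).
Proof.
move=> /H2EP[f2 f0]; apply/H2EP; split=> [|k k0]; first exact: L2E_zpow.
by rewrite fourierV_zpow f0// (le_lt_trans _ k0)// gerBl.
Qed.

Lemma H2E_zvec (l : nat) j : H2E (zvec l j).
Proof. by apply: (@H2E_zpow l (fun=> delta_mx j 0)); exact: H2E_cst. Qed.

(** Fourier coefficients are continuous for the seminorm, so the Hardy
    space is closed. *)
Lemma H2E_adherent (N : V -> Prop) f : (forall u, N u -> H2E u) ->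
  L2 f -> adherent ip N f -> H2E f.
Proof.
move=> NH f2 fN; apply/H2EP; split=> // k k0; apply/colP => i.
rewrite fourierV_inner// mxE.
apply: (adherent_orth SI _ f2 (L2E_zvec k i) fN) => [u /NH/H2E_L2//|u /NH uH].
rewrite -fourierV_inner; last exact: H2E_L2.
by have /H2EP[_ ->//] := uH; rewrite mxE.
Qed.

(** The specification of the representative chosen by [projH2]. *)
Definition is_proj f g : Prop := H2E g /\ forall u, H2E u -> ip (f - g) u = 0.

Lemma projH2P f : L2 f -> is_proj f (projH2 f).
Proof.
move=> f2.
have [g [g2 gadh gorth]] := si_projection SI (@L2E_complete R n) H2E_L2 H2E0 H2E_lin f2.
have ex : exists g, [set g | is_proj f g] g.
  by exists g; split => //; exact: (H2E_adherent (fun u uH => uH)).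
exact: (xgetPex (cst 0) ex).
Qed.

(** The difference d of two projections lies in the Hardy space and is
    orthogonal to it, so it is a null vector of the form. *)
Lemma is_proj_unique f f' g g' : L2 f -> L2 f' -> f = f' %[ae m] ->
  is_proj f g -> is_proj f' g' -> g = g' %[ae m].
Proof.
move=> f2 f'2 ff' [gH gorth] [g'H g'orth].
have dH := H2E_B gH g'H; have d2 := H2E_L2 dH.
have g2 := H2E_L2 gH; have g'2 := H2E_L2 g'H.
have : ip (g - g') (g - g') = 0.
  rewrite (ipBl SI)//.
  have := gorth _ dH; rewrite (ipBl SI)// => /eqP; rewrite subr_eq0 => /eqP <-.
  have := g'orth _ dH; rewrite (ipBl SI)// => /eqP; rewrite subr_eq0 => /eqP <-.
  by rewrite (innerE_ael f2 f'2 d2 ff') subrr.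
move=> /(congr1 (@complex.Re R)) /(innerE_null d2).1.
by apply: filterS => w /(_ Logic.I) E _; apply/eqP; rewrite -subr_eq0; exact/eqP.
Qed.

Inductive analytic_poly : V -> Prop :=
| analytic_poly0 : analytic_poly 0
| analytic_polyS a (k : nat) i u :
    analytic_poly u -> analytic_poly (a *: zvec k i + u).

Lemma analytic_poly_lin a f g :
  analytic_poly f -> analytic_poly g -> analytic_poly (a *: f + g).
Proof.
move=> fp gp; elim: fp => [|b k i u _ IH]; first by rewrite scaler0 add0r.
by rewrite scalerDr scalerA -addrA; exact: analytic_polyS.
Qed.

Lemma analytic_poly_H2E f : analytic_poly f -> H2E f.
Proof.
elim=> [|a k i u _ uH]; first exact: H2E0.
by apply: H2E_lin => //; exact: H2E_zvec.
Qed.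

Lemma fourierV_unique f : L2 f -> (forall k, fourierV f k = 0) -> f = cst 0 %[ae m].
Proof.
move=> f2 f0.
have h i : \forall w \ae m, f w i 0 = 0.
  apply: fourier_unique; first by have /L2EP := f2.
  by move=> k; have /colP/(_ i) := f0 (- k); rewrite !mxE fourierE opprK.
have : \forall w \ae m, forall i, f w i 0 = 0 by apply: filter_forall.
by apply: filterS => w E _; apply/colP => i; rewrite mxE E.
Qed.

(** Analytic polynomials are dense in the Hardy space: the part of f
    orthogonal to them has no nonnegative Fourier coefficients, and no negative
    ones as it is in the Hardy space, hence it vanishes by uniqueness of Fourier
    coefficients.  So orthogonality can be tested on monomials. *)
Lemma H2E_orth f v : H2E f -> L2 v ->
  (forall (k : nat) i, ip (zvec k i) v = 0) -> ip f v = 0.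
Proof.
move=> fH v2 vorth; have f2 := H2E_L2 fH.
have apL u : analytic_poly u -> L2 u by move/analytic_poly_H2E/H2E_L2.
have [g [g2 gadh gorth]] := si_projection SI (@L2E_complete R n)
  apL analytic_poly0 analytic_poly_lin f2.
have gH := H2E_adherent analytic_poly_H2E g2 gadh.
have dH := H2E_B fH gH; have d2 := H2E_L2 dH.
have d0 : f - g = cst 0 %[ae m].
  apply: fourierV_unique => // k; apply/colP => i; rewrite [RHS]mxE.
  case: k => k; last by have /H2EP[_ ->//] := dH; rewrite mxE.
  rewrite fourierV_inner// gorth// -(addr0 (zvec _ _)) -(scale1r (zvec _ _)).
  by apply: analytic_polyS; exact: analytic_poly0.
have -> : ip f v = ip g v + ip (f - g) v by rewrite (ipBl SI)// addrC subrK.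
have -> : ip (f - g) v = 0.
  by apply: (si_null_l SI) => //; exact/(innerE_null d2).2.
rewrite addr0; apply: (adherent_orth SI apL g2 v2 gadh) => u.
elim=> [|a k i w wp IH]; first exact: (ip0l SI).
have w2 := apL _ wp.
by rewrite (si_ipl SI)//; [rewrite vorth IH mulr0 addr0 | exact: L2E_zvec].
Qed.

(** The projection is truncation of the Fourier series; this lets
    projections be identified by comparing coefficients. *)
Lemma is_proj_fourier f g : L2 f -> H2E g ->
  (forall k : nat, fourierV f k = fourierV g k) -> is_proj f g.
Proof.
move=> f2 gH fg; split=> // u uH; have g2 := H2E_L2 gH; have u2 := H2E_L2 uH.
have d2 := siB SI f2 g2.
rewrite (si_ipC SI u2 d2) (H2E_orth uH d2) ?conjc0// => k i.
rewrite (si_ipC SI d2 (L2E_zvec k i)) -fourierV_inner//.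
by rewrite fourierVB// fg subrr mxE conjc0.
Qed.

Lemma is_proj_fourierV f g (k : nat) : L2 f -> is_proj f g ->
  fourierV g k = fourierV f k.
Proof.
move=> f2 [gH gorth]; have g2 := H2E_L2 gH; apply/colP => i.
have := gorth _ (H2E_zvec k i).
rewrite -fourierV_inner; last exact: (siB SI).
by rewrite fourierVB// !mxE => /eqP; rewrite subr_eq0 => /eqP.
Qed.

Definition adjointM F : M := fun w => map_mx conjc (F w)^T.

Lemma LinfM_adjoint F : LinfM F -> LinfM (adjointM F).
Proof.
move=> /LinfMP FL; apply/LinfMP => i j; under eq_fun do rewrite !mxE.
exact: cLp_conj.
Qed.

Lemma innerE_adjoint F f g :
  ip (fun w => F w *m f w) g = ip f (fun w => adjointM F w *m g w).
Proof.
rewrite /innerE; congr cintegral; apply/funext => w.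
under eq_bigr do rewrite mxE mulr_suml.
rewrite exchange_big; apply: eq_bigr => j _.
rewrite mxE rmorph_sum mulr_sumr; apply: eq_bigr => i _.
by rewrite !mxE rmorphM /= conjcK; ring.
Qed.

(** The coefficient at [k < 0] of F f is the inner product of f with the
    adjoint of F applied to a monomial.  By [H2E_orth] it is enough to take
    monomials for f, and then it is a coefficient of F at a negative index. *)
Lemma HinfM_H2E F f : HinfM F -> H2E f -> H2E (fun w => F w *m f w).
Proof.
move=> FH fH; have FL := HinfM_LinfM FH; have f2 := H2E_L2 fH.
apply/H2EP; split=> [|k k0]; first exact: L2E_mul.
apply/colP => i; rewrite [RHS]mxE fourierV_inner; last exact: L2E_mul.
rewrite innerE_adjoint; apply: H2E_orth => //.
  by apply: L2E_mul; [exact: LinfM_adjoint | exact: L2E_zvec].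
move=> l j; rewrite -innerE_adjoint -fourierV_inner; last first.
  by apply: L2E_mul => //; exact: L2E_zvec.
rewrite (_ : (fun w => F w *m zvec l j w) =
    (fun w => zpow l w *: (F w *m delta_mx j 0))); last first.
  by apply/funext => w; rewrite /zvec scalemxAr.
rewrite fourierV_zpow fourierV_mul_cst// (HinfMP FL).1//.
  by rewrite mul0mx mxE.
by rewrite (le_lt_trans _ k0)// gerBl.
Qed.

End hardy.

(** * Toeplitz and Hankel operators *)

Section operators.
Variables (R : realType) (n : nat).
Local Notation C := R[i].
Local Notation m := (@circle_measure R).
Local Notation V := (circle R -> 'cV[C]_n).
Local Notation M := (circle R -> 'M[C]_n).
Local Notation L2 := (@L2E R n).
Local Notation SI := (@semi_innerE R n).
Implicit Types (f g h u : V) (F G Phi Psi : M) (A : 'M[C]_n).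

Lemma flip_ae f g : f = g %[ae m] -> flip f = flip g %[ae m].
Proof.
move=> /(@ae_cconj R (fun w => setT w -> f w = g w)).
by apply: filterS => w E _; rewrite /flip E.
Qed.

Lemma flipK f : flip (flip f) = f.
Proof.
apply/funext => w; rewrite /flip cconjK scalerA /= conjcK.
by rewrite conjc_circle mulVf ?circle_neq0// scale1r.
Qed.

Lemma coprojH2_L2 g : L2 g -> L2 (coprojH2 g).
Proof. by move=> g2; apply: (siB SI g2); exact: H2E_L2 (projH2P g2).1. Qed.

Lemma fourierV_coproj g k : L2 g -> k < 0 -> fourierV (coprojH2 g) k = fourierV g k.
Proof.
move=> g2 k0; have pH := (projH2P g2).1.
have -> : coprojH2 g = g - projH2 g by [].
rewrite fourierVB//; last exact: H2E_L2.
by have /H2EP[_ ->//] := pH; rewrite subr0.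
Qed.

Lemma fourierV_ae f g k : L2 f -> L2 g -> f = g %[ae m] ->
  fourierV f k = fourierV g k.
Proof.
move=> f2 g2 fg; apply/colP => i; rewrite !fourierV_inner//.
by apply: innerE_ael => //; exact: L2E_zvec.
Qed.

(** A Hankel operator remembers exactly the negative Fourier coefficients of
    the product it flips. *)
Lemma hankel_fourier F G f g k : LinfM F -> LinfM G -> L2 f -> L2 g ->
  hankel F f = hankel G g %[ae m] -> k < 0 ->
  fourierV (fun w => F w *m f w) k = fourierV (fun w => G w *m g w) k.
Proof.
move=> FL GL f2 g2 E k0.
have {}E : coprojH2 (fun w => F w *m f w) = coprojH2 (fun w => G w *m g w) %[ae m].
  rewrite -(flipK (coprojH2 (fun w => F w *m f w))).
  rewrite -(flipK (coprojH2 (fun w => G w *m g w))).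
  exact: flip_ae.
have Ff := L2E_mul FL f2; have Gg := L2E_mul GL g2.
rewrite -(fourierV_coproj Ff k0) -(fourierV_coproj Gg k0).
exact: (fourierV_ae _ (coprojH2_L2 Ff) (coprojH2_L2 Gg) E).
Qed.

(** Projecting z g instead of multiplying the projection of g by z picks up
    the coefficient of g at -1, which the shift moves to index 0. *)
Lemma toeplitz_shift Psi h : LinfM Psi -> H2E h ->
  toeplitz Psi (fun w => zpow 1 w *: h w) =
  (fun w => zpow 1 w *: toeplitz Psi h w + fourierV (fun w => Psi w *m h w) (-1)) %[ae m].
Proof.
move=> PsiL hH; have h2 := H2E_L2 hH.
pose g : V := fun w => Psi w *m h w.
have g2 : L2 g by exact: L2E_mul.
have zg2 : L2 (fun w => zpow 1 w *: g w) by exact: L2E_zpow.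
pose c : V := fun=> fourierV g (-1).
have [pH _] := projH2P g2; have p2 := H2E_L2 pH.
have zpH := H2E_zpow 1 pH.
have qH : H2E ((fun w => zpow 1 w *: projH2 g w) + c).
  by apply: H2E_D => //; exact: H2E_cst.
have E : (fun w => Psi w *m (zpow 1 w *: h w)) = (fun w => zpow 1 w *: g w).
  by apply/funext => w; rewrite scalemxAr.
rewrite /toeplitz E.
apply: (is_proj_unique zg2 zg2 _ (projH2P zg2)); first exact: nearW.
apply: is_proj_fourier => // k.
rewrite fourierVD; [|exact: L2E_zpow|exact: L2E_cst].
rewrite !fourierV_zpow fourierV_cst; case: k => [|k].
  rewrite sub0r eqxx scale1r; have /H2EP[_ ->//] := pH; by rewrite add0r.
rewrite scale0r addr0 (_ : k.+1%:Z - 1 = k%:Z); last by rewrite -addn1 PoszD addrK.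
by rewrite (is_proj_fourierV k g2 (projH2P g2)).
Qed.

(** Apply the Hankel property to h and to z h and compare the coefficients
    at k - 1 and at k: the products with F agree, so the defect of
    [toeplitz_shift] is killed by the coefficient of Phi at k.  Monomials h then
    make this defect run through the columns of the coefficients of Psi. *)
Lemma block_hankel_fourierM Phi Psi : LinfM Phi -> LinfM Psi ->
  block_hankel (fun h => hankel Phi (toeplitz Psi h)) ->
  forall k l, k < 0 -> l < 0 -> fourierM Phi k *m fourierM Psi l = 0.
Proof.
move=> PhiL PsiL [F FL XF] k l k0 l0.
have T2 h : H2E h -> L2 (toeplitz Psi h).
  by move=> hH; exact: H2E_L2 (projH2P (L2E_mul PsiL (H2E_L2 hH))).1.
have key h : H2E h ->
    fourierM Phi k *m fourierV (fun w => Psi w *m h w) (-1) = 0.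
  move=> hH; have h2 := H2E_L2 hH; have zhH := H2E_zpow 1 hH.
  have zh2 := H2E_L2 zhH.
  set c := fourierV _ (-1).
  have k10 : k - 1 < 0 by rewrite (lt_trans _ k0)// gtrBl.
  have e1 := hankel_fourier PhiL FL (T2 _ zhH) zh2 (XF _ zhH) k0.
  have e2 := hankel_fourier PhiL FL (T2 _ hH) h2 (XF _ hH) k10.
  have e3 : fourierV (fun w => F w *m (zpow 1 w *: h w)) k =
      fourierV (fun w => F w *m h w) (k - 1).
    by rewrite -fourierV_zpow; congr fourierV; apply/funext => w; rewrite scalemxAr.
  pose a : V := fun w => Phi w *m toeplitz Psi h w.
  pose b : V := fun w => Phi w *m c.
  have ae : (fun w => Phi w *m toeplitz Psi (fun w => zpow 1 w *: h w) w) =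
      ((fun w => zpow 1 w *: a w) + b) %[ae m].
    apply: filterS (toeplitz_shift PsiL hH) => w /(_ Logic.I) E _.
    by rewrite E mulmxDr -scalemxAr.
  have za2 : L2 (fun w => zpow 1 w *: a w) := L2E_zpow 1 (L2E_mul PhiL (T2 _ hH)).
  have b2 : L2 b := L2E_mul PhiL (L2E_cst c).
  have s1 := fourierV_ae k (L2E_mul PhiL (T2 _ zhH)) (siD SI za2 b2) ae.
  have s2 := etrans s1 (etrans (fourierVD k za2 b2)
    (f_equal2 +%R (fourierV_zpow 1 a k) (fourierV_mul_cst c k PhiL))).
  have s3 := etrans e1 (etrans e3 (esym e2)).
  by apply: (addrI (fourierV a (k - 1))); rewrite addr0 -s2.
apply/matrixP => i j; rewrite [RHS]mxE.
have [d ld] : exists d : nat, l = - (d.+1)%:Z.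
  by case: l l0 {key} => // d _; exists d; rewrite NegzE.
(* With [l = - d - 1] the coefficient at -1 of [Psi z^d e_j] is the j-th
   column of the coefficient of Psi at l. *)
have := key _ (H2E_zvec R d j).
rewrite (_ : (fun w => Psi w *m zvec d j w) =
    (fun w => zpow d w *: (Psi w *m delta_mx j 0))); last first.
  by apply/funext => w; rewrite /zvec scalemxAr.
rewrite fourierV_zpow fourierV_mul_cst// (_ : -1 - d%:Z = l); last first.
  by rewrite ld -addn1 PoszD opprD addrC.
rewrite mulmxA -colE => /colP/(_ i); by rewrite !mxE.
Qed.

Definition separating Phi Psi A : Prop :=
  [/\ forall i j, `|A i j| <= 1,
      HinfM (fun w => Phi w *m (1%:M - A)) &
      HinfM (fun w => A *m Psi w)].

Lemma separating_exists Phi Psi : LinfM Phi -> LinfM Psi ->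
  (forall k l, k < 0 -> l < 0 -> fourierM Phi k *m fourierM Psi l = 0) ->
  exists A, separating Phi Psi A.
Proof.
move=> PhiL PsiL PP.
have [A [A1 PhiA APsi]] := @contractive_separation C n {k : int | k < 0} {k : int | k < 0}
  (fun k => fourierM Phi (val k)) (fun k => fourierM Psi (val k))
  (fun k l => PP _ _ (valP k) (valP l)).
exists A; split => //.
  have L : LinfM (fun w => Phi w *m (1%:M - A)) by apply: LinfM_mul => //; exact: LinfM_cst.
  by apply/(HinfMP L) => k k0; rewrite fourierM_mulr//; exact: (PhiA (exist _ k k0)).
have L : LinfM (fun w => A *m Psi w) by apply: LinfM_mul => //; exact: LinfM_cst.
by apply/(HinfMP L) => k k0; rewrite fourierM_mull//; exact: (APsi (exist _ k k0)).
Qed.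

Lemma LinfM_triple Phi Psi A : LinfM Phi -> LinfM Psi ->
  LinfM (fun w => Phi w *m A *m Psi w).
Proof.
move=> PhiL PsiL; apply: (@LinfM_mul _ _ (fun w => Phi w *m A)) => //.
by apply: LinfM_mul => //; exact: LinfM_cst.
Qed.

(** Constant matrices commute with the projection, and the projection fixes
    [A g]. *)
Lemma mulmx_projH2 A g : L2 g -> H2E (fun w => A *m g w) ->
  (fun w => A *m g w) = (fun w => A *m projH2 g w) %[ae m].
Proof.
move=> g2 AgH; have [pH _] := projH2P g2; have p2 := H2E_L2 pH.
have ApH : H2E (fun w => A *m projH2 g w).
  apply/H2EP; split=> [|k k0]; first exact: L2E_mul (LinfM_cst A) p2.
  by rewrite fourierV_mulmx//; have /H2EP[_ ->//] := pH; rewrite mulmx0.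
have Ag2 := H2E_L2 AgH.
apply: (@is_proj_unique _ _ _ _ _ _ Ag2 Ag2 (nearW _ _)) => //.
  exact: is_proj_fourier.
apply: is_proj_fourier => // k.
by rewrite !fourierV_mulmx// (is_proj_fourierV k g2 (projH2P g2)).
Qed.

(** Up to null sets [Phi P(Psi h)] and [Phi A Psi h] differ by the element
    [Phi (1 - A) P(Psi h)] of the Hardy space, which 1 - P kills. *)
Lemma hankel_toeplitz Phi Psi A : LinfM Phi -> LinfM Psi -> separating Phi Psi A ->
  eq_on_H2E (fun h => hankel Phi (toeplitz Psi h))
            (hankel (fun w => Phi w *m A *m Psi w)).
Proof.
move=> PhiL PsiL [_ PhiA APsi] h hH; have h2 := H2E_L2 hH.
apply: flip_ae.
pose g : V := fun w => Psi w *m h w.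
have g2 : L2 g by exact: L2E_mul.
have [pH _] := projH2P g2; have p2 := H2E_L2 pH.
have AgH : H2E (fun w => A *m g w).
  have := HinfM_H2E APsi hH; congr H2E; apply/funext => w.
  by rewrite mulmxA.
have Agp := mulmx_projH2 g2 AgH.
pose x : V := fun w => Phi w *m projH2 g w.
pose y : V := fun w => Phi w *m A *m Psi w *m h w.
pose b : V := fun w => Phi w *m (1%:M - A) *m projH2 g w.
have x2 : L2 x by exact: L2E_mul.
have y2 : L2 y by apply: L2E_mul => //; exact: LinfM_triple.
have bH : H2E b by exact: HinfM_H2E.
have xyb : x = y + b %[ae m].
  apply: filterS Agp => w /(_ Logic.I) E _.
  transitivity (Phi w *m A *m Psi w *m h w +
    Phi w *m (1%:M - A) *m projH2 g w); last by [].
  have -> : Phi w *m A *m Psi w *m h w = Phi w *m (A *m g w).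
    by rewrite /g !mulmxA.
  by rewrite E mulmxBr mulmx1 mulmxBl mulmxA addrC subrK.
have b2 := H2E_L2 bH.
have yb2 := siD SI y2 b2.
have [qH qorth] := projH2P y2.
have projyb : is_proj (y + b) (projH2 y + b).
  split=> [|u uH]; first exact: H2E_D.
  by rewrite opprD addrACA subrr addr0; exact: qorth.
have px := is_proj_unique x2 yb2 xyb (projH2P x2) projyb.
rewrite /coprojH2; apply: filterS2 xyb px => w /(_ Logic.I) e1 /(_ Logic.I) e2 _.
transitivity (x w - projH2 x w); first by [].
transitivity (y w - projH2 y w); last by [].
transitivity ((y w + b w) - (projH2 y w + b w)).
  by congr (_ - _); [exact: e1 | exact: e2].
by rewrite opprD addrACA subrr addr0.
Qed.

End operators.

Theorem theorem2p15 (R : realType) (n : nat) (n_ge1 : (1 <= n)%N)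
    (Phi Psi : circle R -> 'M[R[i]]_n)
    (PhiL : LinfM Phi) (PsiL : LinfM Psi) :
  let good (A : 'M[R[i]]_n) : Prop :=
    [/\ forall i j, `|A i j| <= 1,
        HinfM (fun w => Phi w *m (1%:M - A)) &
        HinfM (fun w => A *m Psi w)] in
  (block_hankel (fun h => hankel Phi (toeplitz Psi h)) <->
     exists A : 'M[R[i]]_n, good A) /\
  (forall A : 'M[R[i]]_n, good A ->
     eq_on_H2E (fun h => hankel Phi (toeplitz Psi h))
               (hankel (fun w => Phi w *m A *m Psi w))).
Proof.
move=> good; split=> [|A]; last exact: hankel_toeplitz.
split=> [XH|[A gA]].
  exact: separating_exists (block_hankel_fourierM PhiL PsiL XH).
exists (fun w => Phi w *m A *m Psi w); first exact: LinfM_triple.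
exact: hankel_toeplitz.
Qed.
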